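(* For any $\epsilon>0$ there exists a $\delta>0$ satisfying the following condition: Let $A$ be a unital C$^*$-algebra and $\alpha$ a flow on $A$. If $D$ is a unital finite-dimensional C$^*$-subalgebra of $A$ such that $$\sup_{|t|\le1}\|(\alpha_t-\mathrm{id})|_D\|<\delta,$$ then there is an $\alpha$-cocycle $u$ such that $\mathrm{Ad}\,u_t\,\alpha_t|_D=\mathrm{id}$ for all $t\in\mathbf{R}$ and $$\max_{|t|\le1}\|u_t-1\|<\epsilon.$$
   Context: A flow $\alpha$ on a unital C$^*$-algebra $A$ is a group homomorphism $t\mapsto\alpha_t$ of $\mathbf{R}$ into the automorphism group of $A$ such that $t\mapsto\alpha_t(x)$ is norm-continuous for each $x\in A$. $\mathcal{U}(A)$ is the unitary group of $A$ and $\mathrm{Ad}\,u(x)=uxu^*$. An $\alpha$-cocycle is a continuous map $u:\mathbf{R}\to\mathcal{U}(A)$ with $u_s\alpha_s(u_t)=u_{s+t}$ for all $s,t\in\mathbf{R}$. In particular $\delta$ depends only on $\epsilon$, not on $A$, $\alpha$ or $D$. The norm $\|(\alpha_t-\mathrm{id})|_D\|$ is the operator norm of the linear map $D\to A$. *)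

(* Defs.v *)
From HB Require Import structures.
From mathcomp Require Import all_boot all_order all_algebra complex.
From mathcomp Require Import all_classical all_reals all_analysis.

Set Implicit Arguments.
Unset Strict Implicit.
Unset Printing Implicit Defensive.

Import Order.TTheory GRing.Theory Num.Theory.
Import numFieldNormedType.Exports.

Local Open Scope classical_set_scope.
Local Open Scope ring_scope.

(* Unital C*-algebras. The library has no common extension of normed modules
   and algebras, so the product is a field of the mixin, and the algType
   structure is derived below on top of the normed module structure. Over the
   scalars R[i] the norm `|x| is R[i]-valued; it is always a nonnegative real. *)
HB.mixin Record CompleteNormedModule_isUnitalCStar (R : realType) A
    of CompleteNormedModule R[i] A := {
  cs_one : A;
  cs_mul : A -> A -> A;
  star : A -> A;
  cs_mulA : associative cs_mul;
  cs_mul1r : left_id cs_one cs_mul;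
  cs_mulr1 : right_id cs_one cs_mul;
  cs_mulDl : left_distributive cs_mul +%R;
  cs_mulDr : right_distributive cs_mul +%R;
  cs_one_neq0 : cs_one != 0;
  cs_scaleAl : forall (a : R[i]) (x y : A),
    a *: cs_mul x y = cs_mul (a *: x) y;
  cs_scaleAr : forall (a : R[i]) (x y : A),
    a *: cs_mul x y = cs_mul x (a *: y);
  starK : involutive star;
  starD : {morph star : x y / x + y};
  starZ : forall (a : R[i]) (x : A), star (a *: x) = a^*%C *: star x;
  starM : forall x y : A, star (cs_mul x y) = cs_mul (star y) (star x);
  cs_norm_mul : forall x y : A, `|cs_mul x y| <= `|x| * `|y|;
  cs_norm_star : forall x : A, `|cs_mul (star x) x| = `|x| ^+ 2
}.

#[short(type="unitalCStarType")]
HB.structure Definition UnitalCStar (R : realType) :=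
  {A of CompleteNormedModule_isUnitalCStar R A & CompleteNormedModule R[i] A}.

#[non_forgetful_inheritance]
HB.instance Definition _ (R : realType) (A : unitalCStarType R) :=
  GRing.Zmodule_isNzRing.Build A cs_mulA cs_mul1r cs_mulr1 cs_mulDl cs_mulDr
    cs_one_neq0.
#[non_forgetful_inheritance]
HB.instance Definition _ (R : realType) (A : unitalCStarType R) :=
  GRing.LSemiModule_isLSemiAlgebra.Build R[i] A (@cs_scaleAl R A).
#[non_forgetful_inheritance]
HB.instance Definition _ (R : realType) (A : unitalCStarType R) :=
  GRing.LSemiAlgebra_isSemiAlgebra.Build R[i] A (@cs_scaleAr R A).

Section CStarDefs.
Variables (R : realType) (A : unitalCStarType R).
Implicit Types (D : set A) (alpha : R -> A -> A) (u : R -> A).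

Definition rnorm (x : A) : R := complex.Re `|x|.

Definition is_unitary (v : A) : Prop := star v * v = 1 /\ v * star v = 1.

Definition Ad (v x : A) : A := v * x * star v.

Definition is_star_automorphism (f : A -> A) : Prop :=
  [/\ linear f, GRing.monoid_morphism f,
      {morph f : x / star x} & bijective f].

Definition is_flow alpha : Prop :=
  [/\ forall t, is_star_automorphism (alpha t),
      forall s t, alpha (s + t) = alpha s \o alpha t
    & forall x, continuous (fun t => alpha t x)].

Definition is_cocycle alpha u : Prop :=
  [/\ forall t, is_unitary (u t), continuous u
    & forall s t, u s * alpha s (u t) = u (s + t)].

(* Unital means that D contains the unit of A itself. *)
Definition is_unital_cstar_subalgebra D : Prop :=
  [/\ D 1,
      forall (a : R[i]) x y, D x -> D y -> D (a *: x + y),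
      forall x y, D x -> D y -> D (x * y),
      forall x, D x -> D (star x)
    & closed D].

Definition finite_dimensional D : Prop :=
  exists (n : nat) (e : 'I_n -> A),
    D = [set x | exists c : 'I_n -> R[i], x = \sum_(i < n) c i *: e i].

Definition opnorm_on D (f : A -> A) : \bar R :=
  ereal_sup [set (rnorm (f x))%:E | x in [set x | D x /\ rnorm x <= 1]].

End CStarDefs.

Definition is_maximum (R : realType) (S : set R) (m : R) : Prop :=
  S m /\ ubound S m.

(* Main.v *)
(* The generator of [alpha] need not be defined on [D], so that [D] is first
   replaced by a unitarily equivalent algebra on which the flow is Lipschitz. The
   average [x |-> \int_0^1 alpha_s x ds] is star-linear, is [delta]-close to the
   identity on [D], and is Lipschitz along [alpha] with constant [delta]; it is
   hence almost multiplicative, also in the algebra norms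
   [|x| + |alpha_h x - x| / h]. Johnson's quadratically convergent iteration turns
   it into a star-homomorphism [rho] on [D], still Lipschitz with constant
   [O(delta)], and [rho = Ad w] on [D] for a unitary [w] close to 1. The errors do
   not depend on [D], as all the corrections are means over the unitary group of
   [D]; such a mean exists as the fixed point of a bounded group acting linearly on
   a convex set of tensors over [D].
   The means [g_h] of [rho v * alpha_h (rho (star v))] then intertwine [rho] and
   [alpha_h rho], and satisfy the cocycle identity up to an error [O(h^2)]. The
   products of the [alpha_(k h) g_h] hence converge, as [h] runs over the powers of
   1/2, to a cocycle [U] for [rho D], which is unitary since [g_h] is unitary up to
   [O(h^2)]; and [u_t = w^* U_t alpha_t(w)]. *)
Require Import Defs.
From HB Require Import structures.
From mathcomp Require Import all_boot all_order all_algebra complex.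
From mathcomp Require Import all_classical all_reals all_analysis.
From mathcomp Require Import ring lra.

Import Order.TTheory GRing.Theory Num.Theory.
Import numFieldNormedType.Exports.

Set Implicit Arguments.
Unset Strict Implicit.
Unset Printing Implicit Defensive.

Local Open Scope classical_set_scope.
Local Open Scope ring_scope.

(* The bare name denotes a matrix predicate of the library. *)
Local Notation is_unitary := Defs.is_unitary.

(** * Normalization of identities in a noncommutative algebra *)

Section NCRing.
Variables (R : realType) (A : unitalCStarType R).

(** For each small [t] a mean over the unitaries of [D] intertwines [D] and [alpha_t D], but the
    cocycle identity then fails by an error quadratic in the displacement of [D]. If this
    displacement is merely below [delta], the error need not shrink with the step, and products over
    finer grids need not converge. A Lipschitz bound makes the error O(h^2), and t / h steps add up
    to O(h). [delta] is uniform because the dimension of [D] enters only through the constant of the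
    fixed point theorem, which serves the existence of the mean and no estimate. All bounds on a
    mean come from its lying in every closed set that is stable under midpoints and contains the
    values at the unitaries. Dyadic steps serve twice: averages along the flow factor into half
    steps and telescope, and each grid of the product construction refines the previous one. *)

Inductive ncexpr :=
| NCvar of nat | NC0 | NC1 | NCadd of ncexpr & ncexpr | NCopp of ncexpr
| NCmul of ncexpr & ncexpr | NCscale of R[i] & ncexpr.

Variable env : seq A.

Fixpoint nceval (e : ncexpr) : A :=
  match e with
  | NCvar n => nth 0 env n
  | NC0 => 0
  | NC1 => 1
  | NCadd e1 e2 => nceval e1 + nceval e2
  | NCopp e1 => - nceval e1
  | NCmul e1 e2 => nceval e1 * nceval e2
  | NCscale a e1 => a *: nceval e1
  end.

Definition ncpoly := seq (seq nat * R[i]).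

Fixpoint word (w : seq nat) : A :=
  if w is n :: w' then nth 0 env n * word w' else 1.

Fixpoint ncval (p : ncpoly) : A :=
  if p is m :: p' then m.2 *: word m.1 + ncval p' else 0.

Fixpoint eqword (v w : seq nat) : bool :=
  match v, w with
  | [::], [::] => true
  | i :: v', j :: w' => if eqn i j then eqword v' w' else false
  | _, _ => false
  end.

Lemma eqwordP v w : eqword v w -> v = w.
Proof.
elim: v w => [|i v IH] [|j w] //=.
by case: ifP => // /eqnP -> /IH ->.
Qed.

Fixpoint ncins (w : seq nat) (a : R[i]) (p : ncpoly) : ncpoly :=
  match p with
  | [::] => [:: (w, a)]
  | m :: p' => if eqword m.1 w then (w, m.2 + a) :: p' else m :: ncins w a p'
  end.

Fixpoint ncaddp (p q : ncpoly) : ncpoly :=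
  if p is m :: p' then ncins m.1 m.2 (ncaddp p' q) else q.

Fixpoint ncscalep (w : seq nat) (a : R[i]) (p : ncpoly) : ncpoly :=
  if p is m :: p' then (cat w m.1, a * m.2) :: ncscalep w a p' else [::].

Fixpoint ncmulp (p q : ncpoly) : ncpoly :=
  if p is m :: p' then ncaddp (ncscalep m.1 m.2 q) (ncmulp p' q) else [::].

Fixpoint ncnorm (e : ncexpr) : ncpoly :=
  match e with
  | NCvar n => [:: ([:: n], 1)]
  | NC0 => [::]
  | NC1 => [:: ([::], 1)]
  | NCadd e1 e2 => ncaddp (ncnorm e1) (ncnorm e2)
  | NCopp e1 => ncscalep [::] (-1) (ncnorm e1)
  | NCmul e1 e2 => ncmulp (ncnorm e1) (ncnorm e2)
  | NCscale a e1 => ncscalep [::] a (ncnorm e1)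
  end.

(** A proposition rather than a test: equality in [R[i]] is not decided by computation, so each
    collected coefficient becomes a goal for [ring] or [field]. *)
Fixpoint nczero (p : ncpoly) : Prop :=
  match p with
  | [::] => True
  | m :: p' => m.2 = 0 /\ nczero p'
  end.

Lemma word_cat w1 w2 : word (w1 ++ w2) = word w1 * word w2.
Proof. by elim: w1 => [|n w1 IH] /=; rewrite ?mul1r ?IH ?mulrA. Qed.

Lemma ncval_ins w a p : ncval (ncins w a p) = a *: word w + ncval p.
Proof.
elim: p => [|[w' b] p IH] //=; case: ifP => [/eqwordP ->|_] /=.
  by rewrite scalerDl addrAC addrC addrCA !addrA.
by rewrite IH addrCA.
Qed.

Lemma ncval_add p q : ncval (ncaddp p q) = ncval p + ncval q.
Proof. by elim: p => [|[w a] p IH] /=; rewrite ?add0r ?ncval_ins ?IH ?addrA. Qed.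

Lemma ncval_scale w a p : ncval (ncscalep w a p) = a *: (word w * ncval p).
Proof.
elim: p => [|[w' b] p IH] /=; first by rewrite mulr0 scaler0.
by rewrite IH mulrDr scalerDr word_cat -scalerAr scalerA.
Qed.

Lemma ncval_mul p q : ncval (ncmulp p q) = ncval p * ncval q.
Proof.
elim: p => [|[w a] p IH] /=; first by rewrite mul0r.
by rewrite ncval_add ncval_scale IH mulrDl scalerAl.
Qed.

Lemma ncval_norm e : ncval (ncnorm e) = nceval e.
Proof.
elim: e => [n|||e1 IH1 e2 IH2|e IH|e1 IH1 e2 IH2|a e IH] //=.
- by rewrite mulr1 scale1r addr0.
- by rewrite scale1r addr0.
- by rewrite ncval_add IH1 IH2.
- by rewrite ncval_scale IH mul1r scaleN1r.
- by rewrite ncval_mul IH1 IH2.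
- by rewrite ncval_scale IH mul1r.
Qed.

Lemma nczero_val p : nczero p -> ncval p = 0.
Proof. by elim: p => [|[w a] p IH] //= [-> /IH ->]; rewrite scale0r addr0. Qed.

Lemma ncringP e1 e2 :
  nczero (ncnorm (NCadd e1 (NCopp e2))) -> nceval e1 = nceval e2.
Proof.
by move=> /nczero_val; rewrite ncval_norm /= => /eqP; rewrite subr_eq0 => /eqP.
Qed.

End NCRing.

Ltac nc_index x l :=
  match l with
  | x :: _ => constr:(0%N)
  | _ :: ?l' => let n := nc_index x l' in constr:(S n)
  end.

Ltac nc_addvar x l :=
  match l with
  | nil => constr:(x :: nil)
  | x :: _ => l
  | ?y :: ?l' => let l'' := nc_addvar x l' in constr:(y :: l'')
  end.

Ltac nc_vars t l :=
  match t with
  | @GRing.zero _ => l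
  | @GRing.one _ => l
  | @GRing.add _ ?a ?b => let l1 := nc_vars a l in nc_vars b l1
  | @GRing.mul _ ?a ?b => let l1 := nc_vars a l in nc_vars b l1
  | @GRing.opp _ ?a => nc_vars a l
  | @GRing.scale _ _ _ ?a => nc_vars a l
  | @GRing.natmul _ ?a 2%N => nc_vars a l
  | _ => nc_addvar t l
  end.

Ltac nc_reify R t l :=
  match t with
  | @GRing.zero _ => constr:(@NC0 R)
  | @GRing.one _ => constr:(@NC1 R)
  | @GRing.add _ ?a ?b =>
      let a' := nc_reify R a l in let b' := nc_reify R b l in
      constr:(@NCadd R a' b')
  | @GRing.mul _ ?a ?b =>
      let a' := nc_reify R a l in let b' := nc_reify R b l in
      constr:(@NCmul R a' b')
  | @GRing.opp _ ?a => let a' := nc_reify R a l in constr:(@NCopp R a')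
  | @GRing.scale _ _ ?r ?a =>
      let a' := nc_reify R a l in constr:(@NCscale R r a')
  | @GRing.natmul _ ?a 2%N =>
      let a' := nc_reify R a l in constr:(@NCadd R a' a')
  | _ => let n := nc_index t l in constr:(@NCvar R n)
  end.

Ltac ncring_norm :=
  lazymatch goal with
  | A : UnitalCStar.type ?R |- @eq _ ?a ?b =>
      let l0 := nc_vars a (@nil (UnitalCStar.sort A)) in
      let l := nc_vars b l0 in
      let a' := nc_reify R a l in
      let b' := nc_reify R b l in
      change (@nceval R A l a' = @nceval R A l b');
      apply: (@ncringP R A l);
      cbv [ncnorm ncaddp ncins ncscalep ncmulp nczero eqword cat fst snd eqn]
  end.

Ltac ncring :=
  ncring_norm; do ?[split]; try exact I; try (by ring); try by field.

(** * Norm and limits *)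

Section Norm.
Variables (R : realType) (A : unitalCStarType R).
Implicit Types (x y z v : A) (r : R).
Local Notation N := (@rnorm R A).
Local Open Scope complex_scope.

Lemma normE x : `|x| = (N x)%:C.
Proof. by rewrite /rnorm RRe_real ?normr_real. Qed.

Lemma rnorm_ge0 x : 0 <= N x.
Proof. by rewrite -ler0c -normE. Qed.

Lemma rnorm0 : N 0 = 0.
Proof. by rewrite /rnorm normr0. Qed.

Lemma rnorm_eq0 x : (N x == 0) = (x == 0).
Proof. by rewrite -[in RHS](normr_eq0 x) normE (inj_eq (@complexI R)). Qed.

Lemma rnormN x : N (- x) = N x.
Proof. by rewrite /rnorm normrN. Qed.

Lemma rnormD x y : N (x + y) <= N x + N y.
Proof. by rewrite -lecR rmorphD /= -!normE ler_normD. Qed.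

Lemma rnormB x y : N (x - y) <= N x + N y.
Proof. by rewrite -(rnormN y) rnormD. Qed.

Lemma rnorm_distC x y : N (x - y) = N (y - x).
Proof. by rewrite -rnormN opprB. Qed.

Lemma rnorm_dist3 y x z : N (x - z) <= N (x - y) + N (y - z).
Proof. by rewrite (le_trans _ (rnormD _ _))// addrA subrK. Qed.

Lemma rnorm_distB x y : `|N x - N y| <= N (x - y).
Proof.
have h a b : N a - N b <= N (a - b).
  by rewrite lerBlDr (le_trans _ (rnormD _ _))// subrK.
by rewrite ler_norml h andbT lerNl opprB rnorm_distC h.
Qed.

Lemma rnormM x y : N (x * y) <= N x * N y.
Proof. by rewrite -lecR rmorphM /= -!normE; exact: cs_norm_mul. Qed.

Lemma rnormZc (a : R[i]) x : N (a *: x) = complex.Re `|a| * N x.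
Proof.
rewrite /rnorm normrZ (normE x) -[in LHS](RRe_real (normr_real a)).
by rewrite -rmorphM.
Qed.

Lemma rnormZ r x : N (r%:C *: x) = `|r| * N x.
Proof. by rewrite rnormZc normc_def /= expr0n addr0 sqrtr_sqr. Qed.

Lemma half_realE : 2^-1 = (2^-1)%:C :> R[i].
Proof. by rewrite fmorphV rmorph_nat. Qed.

(* [scalerAl] and [scalerAr] produce products that [ncring] does not recognize
   syntactically inside its atoms. *)
Lemma cscalerl (a : R[i]) x y : (a *: x) * y = a *: (x * y).
Proof. by rewrite scalerAl. Qed.

Lemma cscalerr (a : R[i]) x y : x * (a *: y) = a *: (x * y).
Proof. by rewrite scalerAr. Qed.

Lemma rnorm_sum (I : Type) (s : seq I) (P : pred I) (F : I -> A) :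
  N (\sum_(i <- s | P i) F i) <= \sum_(i <- s | P i) N (F i).
Proof.
elim/big_ind2: _ => [|x a y b xa yb|//]; first by rewrite rnorm0.
by rewrite (le_trans (rnormD _ _))// lerD.
Qed.

Lemma starZr r x : star (r%:C *: x) = r%:C *: star x.
Proof. by rewrite starZ conjc_real. Qed.

Lemma star0 : star 0 = 0 :> A.
Proof. by rewrite -[in LHS](scale0r 0) (starZr 0) scale0r. Qed.

Lemma starN x : star (- x) = - star x.
Proof. by apply/eqP; rewrite -addr_eq0 -starD addNr star0. Qed.

Lemma starB x y : star (x - y) = star x - star y.
Proof. by rewrite starD starN. Qed.

Lemma star_mul x y : star (x * y) = star y * star x.
Proof. exact: starM. Qed.

Lemma star1 : star 1 = 1 :> A.
Proof. by rewrite -[LHS]mulr1 -[X in _ * X]starK -star_mul mulr1 starK. Qed.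

Lemma rnorm_starM x : N (star x * x) = N x ^+ 2.
Proof.
apply: complexI; rewrite rmorphXn /= -!normE; exact: cs_norm_star.
Qed.

(** The C*-identity gives [N y ^+ 2 <= N (star y) * N y]; dividing by [N y], and taking [star y] for
    [y], yields both inequalities. *)
Lemma rnorm_star x : N (star x) = N x.
Proof.
have h y : N y <= N (star y).
  have [->|y0] := eqVneq y 0; first by rewrite star0.
  have Ny : 0 < N y by rewrite lt_def rnorm_eq0 y0 rnorm_ge0.
  by rewrite -(ler_pM2r Ny) -expr2 -rnorm_starM rnormM.
by apply/le_anti; rewrite h andbT -{2}(starK x) h.
Qed.

Lemma rnorm1 : N 1 = 1.
Proof.
have : N 1 ^+ 2 = N 1 by rewrite -rnorm_starM star1 mulr1.
have : N 1 != 0 by rewrite rnorm_eq0 oner_neq0.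
by move=> h; rewrite expr2 -{3}[N 1]mulr1 => /(mulfI h).
Qed.

Lemma unitary_norm v : is_unitary v -> N v = 1.
Proof.
case=> vv _; have := rnorm_starM v; rewrite vv rnorm1 => /esym/eqP.
by rewrite sqrf_eq1 => /orP[/eqP //|/eqP e]; have := rnorm_ge0 v; rewrite e; lra.
Qed.

Lemma unitary_star v : is_unitary v -> is_unitary (star v).
Proof. by case=> h1 h2; split; rewrite starK. Qed.

Lemma unitary1 : is_unitary (1 : A).
Proof. by split; rewrite star1 mulr1. Qed.

Lemma unitaryM v w : is_unitary v -> is_unitary w -> is_unitary (v * w).
Proof.
case=> v1 v2 [w1 w2]; split; rewrite star_mul.
  by rewrite mulrA -(mulrA (star w)) v1 mulr1.
by rewrite mulrA -(mulrA v) w2 mulr1.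
Qed.

Lemma rnormM_le x y a b : N x <= a -> N y <= b -> N (x * y) <= a * b.
Proof. by move=> xa yb; rewrite (le_trans (rnormM _ _))// ler_pM ?rnorm_ge0. Qed.

Lemma rnormM1l x y a : N x <= 1 -> N y <= a -> N (x * y) <= a.
Proof. by move=> h k; rewrite -[a]mul1r rnormM_le. Qed.

Lemma rnormM1r x y a : N x <= a -> N y <= 1 -> N (x * y) <= a.
Proof. by move=> h k; rewrite -[a]mulr1 rnormM_le. Qed.

End Norm.

Section Limits.
Variables (R : realType) (A : unitalCStarType R).
Implicit Types (x y z v l : A) (r : R).
Local Notation N := (@rnorm R A).
Local Open Scope complex_scope.

Section filters.
Context {T : Type} {F : set_system T} {FF : ProperFilter F}.
Implicit Types (f g : T -> A).

Lemma cvg_rnormP f l : f @ F --> l <-> (fun t => N (f t - l)) @ F --> (0 : R).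
Proof.
split=> [/cvgrPdist_lt h|/cvgrPdist_lt h].
  apply/cvgrPdist_lt => e e0.
  have e0' : 0 < e%:C :> R[i] by rewrite ltcR.
  apply: filterS (h _ e0') => t; rewrite normE ltcR.
  by rewrite sub0r normrN ger0_norm ?rnorm_ge0// rnorm_distC.
apply/cvgrPdist_lt => e e0.
have eE : e = (complex.Re e)%:C by rewrite RRe_real ?gtr0_real.
have e0' : 0 < complex.Re e by rewrite -ltcR -eE.
apply: filterS (h _ e0') => t.
by rewrite sub0r normrN ger0_norm ?rnorm_ge0// normE eE ltcR rnorm_distC.
Qed.

Lemma cvg_rnorm_le f l (b : T -> R) :
  (\forall t \near F, N (f t - l) <= b t) -> b @ F --> (0 : R) -> f @ F --> l.
Proof.
move=> h b0; apply/cvg_rnormP; apply: squeeze_cvgr (cvg_cst 0) b0.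
by apply: filterS h => t ->; rewrite rnorm_ge0.
Qed.

Lemma cvg_rnorm f l : f @ F --> l -> (fun t => N (f t)) @ F --> N l.
Proof.
move=> /cvg_rnormP h; apply/cvgrPdist_lt => e e0.
move/cvgrPdist_lt: h => /(_ _ e0); apply: filterS => t.
rewrite sub0r normrN ger0_norm ?rnorm_ge0//; apply: le_lt_trans.
by rewrite distrC rnorm_distB.
Qed.

Lemma cvg_rnorm_bound f l c :
  f @ F --> l -> (\forall t \near F, N (f t) <= c) -> N l <= c.
Proof. by move=> /cvg_rnorm fl h; exact: cvgr_to_le fl h. Qed.

Lemma cvg_rlip f (h : A -> A) l c :
  (forall x y, h (x - y) = h x - h y) -> (forall x, N (h x) <= c * N x) ->
  f @ F --> l -> (fun t => h (f t)) @ F --> h l.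
Proof.
move=> hB hc /cvg_rnormP fl; apply: (@cvg_rnorm_le _ _ (fun t => c * N (f t - l))).
  by near=> t; rewrite -hB.
by rewrite -(mulr0 c); apply: cvgM => //; exact: cvg_cst.
Unshelve. all: by end_near. Qed.

Lemma cvg_cstarM f g l m :
  f @ F --> l -> g @ F --> m -> (fun t => f t * g t) @ F --> l * m.
Proof.
move=> fl gm.
apply: (@cvg_rnorm_le _ _ (fun t => N (f t - l) * N (g t) + N l * N (g t - m))).
  near=> t.
  have -> : f t * g t - l * m = (f t - l) * g t + l * (g t - m) by ncring.
  by rewrite (le_trans (rnormD _ _))// lerD// rnormM.
have -> : (0 : R) = 0 * N m + N l * 0 by rewrite mul0r mulr0 addr0.
apply: cvgD; apply: cvgM.
- exact/cvg_rnormP.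
- exact: cvg_rnorm.
- exact: cvg_cst.
- exact/cvg_rnormP.
Unshelve. all: by end_near. Qed.

Lemma cvg_mull x f l : f @ F --> l -> (fun t => x * f t) @ F --> x * l.
Proof. by apply: cvg_cstarM; exact: cvg_cst. Qed.

Lemma cvg_mulr x f l : f @ F --> l -> (fun t => f t * x) @ F --> l * x.
Proof. by move=> fl; apply: cvg_cstarM fl _; exact: cvg_cst. Qed.

Lemma cvg_star f l : f @ F --> l -> (fun t => star (f t)) @ F --> star l.
Proof.
apply: (@cvg_rlip _ _ _ 1) => [x y|x]; first by rewrite starB.
by rewrite mul1r rnorm_star.
Qed.

Lemma cvg_eq f g l m :
  f @ F --> l -> g @ F --> m -> (forall t, f t = g t) -> l = m.
Proof.
move=> fl gm /funext fg; move: gm; rewrite -fg => gm.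
exact: (@cvg_unique _ (@norm_hausdorff _ A) (f @ F)).
Qed.

End filters.

Lemma cvg_half_pow (c : R) : (fun n => c * 2^-1 ^+ n) @ \oo --> (0 : R).
Proof.
rewrite -(mulr0 c); apply: cvgM; first exact: cvg_cst.
by apply: cvg_expr; rewrite ger0_norm; lra.
Qed.

Lemma cauchy_rnorm_ex (a : nat -> A) :
  (forall e, 0 < e -> exists n, forall m, (n <= m)%N -> N (a m - a n) <= e) ->
  cvg (a @ \oo).
Proof.
move=> h; apply: cauchy_cvg; apply: cauchy_exP => e e0.
have eE : e = (complex.Re e)%:C by rewrite RRe_real ?gtr0_real.
have e0' : 0 < complex.Re e / 2 by rewrite divr_gt0// -ltcR -eE.
have [n hn] := h _ e0'.
exists (a n), n => // m /= nm; rewrite -ball_normE /ball_ /=.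
rewrite normE eE ltcR rnorm_distC (le_lt_trans (hn _ nm))//; lra.
Qed.

Lemma cauchy_cvg_rnorm (a : nat -> A) (b : nat -> R) :
  b @ \oo --> (0 : R) -> (forall n m, (n <= m)%N -> N (a m - a n) <= b n) ->
  exists l, a @ \oo --> l /\ forall n, N (l - a n) <= b n.
Proof.
move=> b0 ab.
have ca : cvg (a @ \oo).
  apply: cauchy_rnorm_ex => e e0; move/cvgrPdist_lt: b0 => /(_ _ e0)[n _ bn].
  exists n => m nm; apply: le_trans (ab _ _ nm) _; apply: ltW.
  have := bn n (leqnn n) => /=; rewrite sub0r normrN.
  exact: le_lt_trans (ler_norm _).
exists (lim (a @ \oo)); split => // n.
apply: (@cvg_rnorm_bound _ \oo _ (fun m => a m - a n)).
  by apply: cvgB => //; exact: cvg_cst.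
by near=> m; apply: ab; near: m; exact: nbhs_infty_ge.
Unshelve. all: by end_near. Qed.

Lemma geometric_cvg (a : nat -> A) (c : R) :
  (forall n, N (a n.+1 - a n) <= c * 2^-1 ^+ n) ->
  exists l, a @ \oo --> l /\ forall n, N (l - a n) <= 2 * c * 2^-1 ^+ n.
Proof.
move=> h; apply: cauchy_cvg_rnorm; first exact: cvg_half_pow.
move=> n m /subnKC <-; move: (m - n)%N => k.
(* Subtracting the tail that remains after [k] terms is what lets the induction on [k] close. *)
suff : N (a (n + k)%N - a n) <= 2 * c * 2^-1 ^+ n - 2 * c * 2^-1 ^+ (n + k).
  move=> /le_trans; apply; rewrite lerBlDr lerDl mulr_ge0 ?exprn_ge0 ?invr_ge0//.
  have := le_trans (rnorm_ge0 _) (h 0%N); rewrite expr0; lra.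
elim: k => [|k IH]; first by rewrite addn0 !subrr rnorm0.
rewrite addnS (le_trans (rnorm_dist3 (a (n + k)%N) _ _))//.
have := h (n + k)%N; rewrite exprS; lra.
Qed.

End Limits.

(** * Inverse square roots and contractivity of automorphisms *)

Section InvSqrt.
Variables (R : realType) (A : unitalCStarType R).
Implicit Types (x y z v l h : A) (r : R).
Local Notation N := (@rnorm R A).
Local Open Scope complex_scope.

Definition seq_closed (P : A -> Prop) : Prop :=
  forall (a : nat -> A) l, a @ \oo --> l -> (forall n, P (a n)) -> P l.

Lemma closed_seq_closed (D : set A) : closed D -> seq_closed D.
Proof.
move=> cD a l al Da; apply: (closed_cvg D cD _ _ al).
by near=> n; exact: Da.
Unshelve. all: by end_near. Qed.

Lemma commutant_seq_closed x : seq_closed (fun y => x * y = y * x).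
Proof.
move=> a l al xa; exact: (cvg_eq (cvg_mull al) (cvg_mulr al) xa).
Qed.

(* [(1 + y)^2 (1 - E) = 1] rewritten as a fixed point equation in [y]. *)
Definition inv_sqrt_step (E y : A) : A :=
  2^-1 *: (E * ((1 + y) * (1 + y)) - y * y).

Lemma sqr1D_comm x y : x * y = y * x ->
  x * ((1 + y) * (1 + y)) = (1 + y) * (1 + y) * x.
Proof.
move=> xy.
have h : x * (1 + y) = (1 + y) * x by rewrite mulrDr mulrDl mulr1 mul1r xy.
by rewrite mulrA h -mulrA h mulrA.
Qed.

Lemma inv_sqrt_step_comm (E x y : A) : x * E = E * x -> x * y = y * x ->
  x * inv_sqrt_step E y = inv_sqrt_step E y * x.
Proof.
move=> xE xy; rewrite /inv_sqrt_step -scalerAr -scalerAl mulrBr mulrBl.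
congr (_ *: (_ - _)); last by rewrite mulrA xy -mulrA xy mulrA.
rewrite [LHS]mulrA xE -[LHS]mulrA (sqr1D_comm xy).
by rewrite [LHS]mulrA.
Qed.

Lemma rnorm_half x : N (2^-1 *: x) = 2^-1 * N x.
Proof.
rewrite half_realE.
by rewrite rnormZ ger0_norm ?invr_ge0.
Qed.

Lemma inv_sqrt_step_le (E y : A) e : N E <= e -> e <= 20^-1 -> N y <= e ->
  N (inv_sqrt_step E y) <= e.
Proof.
move=> Ee e20 ye; have := rnorm_ge0 y => y0.
rewrite rnorm_half.
have h1 : N (1 + y) <= 1 + e by rewrite (le_trans (rnormD _ _))// rnorm1 lerD2l.
have h2 := rnormM_le Ee (rnormM_le h1 h1).
have h3 := rnormM_le ye ye.
have := rnormB (E * ((1 + y) * (1 + y))) (y * y); nra.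
Qed.

Lemma inv_sqrt_step_contract (E y z : A) e : N E <= e -> e <= 20^-1 ->
  N y <= e -> N z <= e ->
  N (inv_sqrt_step E y - inv_sqrt_step E z) <= 2^-1 * N (y - z).
Proof.
move=> Ee e20 ye ze; have := rnorm_ge0 y => y0.
have -> : inv_sqrt_step E y - inv_sqrt_step E z = 2^-1 *:
   (E * ((1 + y) * (y - z) + (y - z) * (1 + z)) -
     (y * (y - z) + (y - z) * z)).
  by rewrite /inv_sqrt_step; ncring.
rewrite rnorm_half ler_pM2l//.
have h1 : N (1 + y) <= 1 + e by rewrite (le_trans (rnormD _ _))// rnorm1 lerD2l.
have h1' : N (1 + z) <= 1 + e by rewrite (le_trans (rnormD _ _))// rnorm1 lerD2l.
set d := y - z; have d0 := rnorm_ge0 d.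
have h2 : N ((1 + y) * d + d * (1 + z)) <= (2 + 2 * e) * N d.
  rewrite (le_trans (rnormD _ _))//.
  have := rnormM_le h1 (lexx (N d)); have := rnormM_le (lexx (N d)) h1'; lra.
have h3 := rnormM_le Ee h2.
have h4 : N (y * d + d * z) <= 2 * e * N d.
  rewrite (le_trans (rnormD _ _))//.
  have := rnormM_le ye (lexx (N d)); have := rnormM_le (lexx (N d)) ze; lra.
have h5 := rnormB (E * ((1 + y) * d + d * (1 + z))) (y * d + d * z).
apply: le_trans h5 _; apply: le_trans (lerD h3 h4) _.
rewrite mulrA -mulrDl ler_piMl//; nra.
Qed.

(** [z - 1] is the limit of iterates from 0, so it lies in every sequentially closed set that
    contains 0 and is stable under the step. Self-adjointness, commutation and membership in [D] all
    follow from this, without power series. *)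
Lemma inv_sqrt (E : A) : star E = E -> N E <= 20^-1 ->
  exists z, [/\ star z = z, (1 - E) * (z * z) = 1, N (z - 1) <= N E,
    forall x, x * E = E * x -> x * z = z * x &
    forall D, is_unital_cstar_subalgebra D -> D E -> D z].
Proof.
move=> sE E20.
pose a n := iter n (inv_sqrt_step E) 0.
have aE n : N (a n) <= N E.
  elim: n => [|n IH] /=; first by rewrite rnorm0 rnorm_ge0.
  exact: inv_sqrt_step_le.
have da n : N (a n.+1 - a n) <= N E * 2^-1 ^+ n.
  elim: n => [|n IH]; first by rewrite subr0 expr0 mulr1; exact: aE.
  apply: le_trans (inv_sqrt_step_contract (lexx _) E20 (aE n.+1) (aE n)) _.
  by rewrite exprS mulrCA ler_pM2l.
have [l [al _]] := geometric_cvg da.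
have lE : N l <= N E by apply: (cvg_rnorm_bound al); near=> n; exact: aE.
have fl : l = inv_sqrt_step E l.
  apply: (@cvg_eq _ _ _ \oo _ (fun n => a n.+1) (fun n => inv_sqrt_step E (a n))) => //.
    by rewrite (cvg_shiftS a (nbhs l)).
  move/cvg_rnormP: al => h.
  apply: (@cvg_rnorm_le _ _ _ _ _ _ _ (fun n => 2^-1 * N (a n - l))).
    by near=> n; exact: inv_sqrt_step_contract (lexx _) E20 (aE _) lE.
  by rewrite -(mulr0 2^-1); apply: cvgM => //; exact: cvg_cst.
have P0 (P : A -> Prop) : P 0 -> (forall y, P y -> P (inv_sqrt_step E y)) ->
    seq_closed P -> P l.
  by move=> p0 ps pl; apply: (pl _ _ al); elim=> [|n]; [exact: p0|exact: ps].
exists (1 + l); split.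
(* [star] reverses the factors of [E * ((1 + y) * (1 + y))], hence commutation with [E] is carried
   along. *)
- have := P0 (fun y => star y = y /\ E * y = y * E).
  case=> [|y [sy Ey]|b m bm hb|sl _].
  + by rewrite star0 mulr0 mul0r.
  + split; last exact: inv_sqrt_step_comm.
    rewrite /inv_sqrt_step.
    rewrite half_realE.
    by rewrite starZr starB !star_mul starD star1 sy sE sqr1D_comm.
  + split; last by apply: commutant_seq_closed bm _ => n; case: (hb n).
    by apply: (cvg_eq (cvg_star bm) bm) => n; case: (hb n).
  by rewrite starD star1 sl.
- have -> : (1 - E) * ((1 + l) * (1 + l)) =
     1 + 2 *: (l - inv_sqrt_step E l) by rewrite /inv_sqrt_step; ncring.
  by rewrite -fl subrr scaler0 addr0.
- by rewrite addrC addKr.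
- move=> x xE; rewrite mulrDr mulrDl mulr1 mul1r; congr (_ + _).
  apply: (P0 (fun y => x * y = y * x)); last exact: commutant_seq_closed.
    by rewrite mulr0 mul0r.
  by move=> y; exact: inv_sqrt_step_comm.
- move=> D [D1 Dl DM Ds cD] DE.
  have D0 : D 0 by have := Dl (-1) 1 1 D1 D1; rewrite scaleN1r addNr.
  have Dadd x y : D x -> D y -> D (x + y).
    by move=> dx dy; have := Dl 1 x y dx dy; rewrite scale1r.
  have DZ c x : D x -> D (c *: x).
    by move=> dx; have := Dl c x 0 dx D0; rewrite addr0.
  have DB x y : D x -> D y -> D (x - y).
    by move=> dx dy; rewrite -(scaleN1r y); apply: Dadd => //; exact: DZ.
  apply: (Dadd) => //; apply: P0; [exact: D0|move=> y dy|exact: closed_seq_closed].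
  have D1y : D (1 + y) by exact: Dadd.
  by apply: (DZ); apply: (DB); [apply: (DM) => //; exact: DM|exact: DM].
Unshelve. all: by end_near. Qed.

End InvSqrt.

Section Subalgebra.
Variables (R : realType) (A : unitalCStarType R) (D : set A).
Hypothesis hD : is_unital_cstar_subalgebra D.
Implicit Types (x y z : A).

Lemma suba1 : D 1. Proof. by case: hD. Qed.

Lemma subaM x y : D x -> D y -> D (x * y). Proof. by case: hD => _ _ h _ _; exact: h. Qed.

Lemma suba_star x : D x -> D (star x). Proof. by case: hD => _ _ _ h _; exact: h. Qed.

Lemma suba0 : D 0.
Proof. by case: hD => D1 h _ _ _; have := h (-1) 1 1 D1 D1; rewrite scaleN1r addNr. Qed.

Lemma subaD x y : D x -> D y -> D (x + y).
Proof. by case: hD => _ h _ _ _ dx dy; have := h 1 x y dx dy; rewrite scale1r. Qed.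

Lemma subaZ (c : R[i]) x : D x -> D (c *: x).
Proof. by case: hD => _ h _ _ _ dx; have := h c x 0 dx suba0; rewrite addr0. Qed.

Lemma subaN x : D x -> D (- x).
Proof. by rewrite -scaleN1r; exact: subaZ. Qed.

Lemma subaB x y : D x -> D y -> D (x - y).
Proof. by move=> dx dy; apply: subaD => //; exact: subaN. Qed.

End Subalgebra.

Lemma setT_subalgebra (R : realType) (A : unitalCStarType R) :
  is_unital_cstar_subalgebra (@setT A).
Proof. by split => //; exact: closedT. Qed.

Section Dilation.
Variables (R : realType) (A : unitalCStarType R).
Implicit Types (x y z v l h u : A) (r : R).
Local Notation N := (@rnorm R A).
Local Open Scope complex_scope.

(* [h] is the real part of the unitary [h + i (1 - h^2)^(1/2)]. *)
Lemma unitary_dilation h (D : set A) : is_unital_cstar_subalgebra D -> D h ->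
  star h = h -> N h <= 5^-1 ->
  exists u, [/\ is_unitary u, D u & h = 2^-1 *: (u + star u)].
Proof.
move=> hD Dh sh h5.
have sE : star (h * h) = h * h by rewrite star_mul sh.
have NE : N (h * h) <= 20^-1 by rewrite (le_trans (rnormM_le h5 h5))//; lra.
have [z [sz z2 _ cz Dz]] := inv_sqrt sE NE.
have Dhh : D (h * h) by exact: subaM.
have hz : h * z = z * h by apply: cz; rewrite mulrA.
set a := 1 - h * h in z2.
have ez : a * z = z * a.
  by rewrite /a mulrBr mulrBl mul1r mulr1 -(mulrA h h z) hz mulrA hz -mulrA.
have ha : h * a = a * h by rewrite /a; ncring.
(* Since [z] is the inverse square root of [a], this is the square root of [a]. *)
set k := a * z.
have sk : star k = k by rewrite /k star_mul starB star1 star_mul sh sz ez.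
have hk : h * k = k * h by rewrite /k [LHS]mulrA ha -(mulrA a h z) hz mulrA.
have k2 : k * k = a by rewrite {2}/k ez /k -mulrA (mulrA z) mulrA z2 mul1r.
exists (h + 'i *: k).
have su : star (h + 'i *: k) = h - 'i *: k.
  have ci : ('i)^* = - 'i :> R[i] by apply/eqP; rewrite eq_complex /= oppr0 !eqxx.
  by rewrite starD starZ sh sk ci scaleNr.
have ii : ('i : R[i]) * 'i = -1 by rewrite -expr2 sqr_i.
split.
- have e : h * h + k * k = 1 by rewrite k2 addrC subrK.
  split; rewrite su.
    have -> : (h - 'i *: k) * (h + 'i *: k) =
      h * h - ('i * 'i) *: (k * k) + 'i *: (h * k - k * h) by ncring.
    by rewrite ii hk subrr scaler0 addr0 scaleN1r opprK.
  have -> : (h + 'i *: k) * (h - 'i *: k) =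
      h * h - ('i * 'i) *: (k * k) - 'i *: (h * k - k * h) by ncring.
  by rewrite ii hk subrr scaler0 subr0 scaleN1r opprK.
- apply: subaD => //; apply: subaZ => //; apply: subaM => //; last exact: Dz.
  by apply: subaB => //; exact: suba1.
- by rewrite su; ncring.
Qed.

End Dilation.

(** * Contractivity of star-automorphisms *)

Section Contractive.
Variables (R : realType) (A : unitalCStarType R).
Implicit Types (x y z v l h u : A) (r : R).
Local Notation N := (@rnorm R A).
Local Open Scope complex_scope.

(** If [a < b], Bernoulli's inequality makes [(b / a) ^+ (2 ^ n)] exceed every constant. *)
Lemma le_of_pow (a b c : R) : 0 <= a -> 0 <= b ->
  (forall n, b ^+ (2 ^ n) <= c * a ^+ (2 ^ n)) -> b <= a.
Proof.
move=> a0 b0 h; rewrite leNgt; apply/negP => ab.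
have bp : 0 < b by apply: le_lt_trans ab.
have [a_eq0|a_neq0] := eqVneq a 0.
  by have := h 0%N; rewrite a_eq0 expn0 !expr1 mulr0; rewrite leNgt bp.
have ap : 0 < a by rewrite lt_def a_neq0.
pose d := b / a - 1.
have d0 : 0 < d by rewrite subr_gt0 ltr_pdivlMr// mul1r.
have B n : 1 + n%:R * d <= (b / a) ^+ n.
  elim: n => [|n IH]; first by rewrite mul0r addr0 expr0.
  have e : b / a = 1 + d by rewrite /d addrC subrK.
  rewrite exprS {1}e (le_trans _ (ler_wpM2l _ IH))//; last by rewrite addr_ge0// ltW.
  have n0 : 0 <= n%:R :> R by exact: ler0n.
  rewrite -natr1; nra.
pose n := (Num.truncn (`|c| / d)).+1.
have nc : `|c| / d < n%:R by have /andP[] := truncn_itv (divr_ge0 (normr_ge0 c) (ltW d0)).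
have : (b / a) ^+ (2 ^ n) <= c.
  by rewrite expr_div_n ler_pdivrMr ?exprn_gt0.
apply/negP; rewrite -ltNge; apply: lt_le_trans (B _).
have n2 : n%:R <= (2 ^ n)%:R :> R by rewrite ler_nat ltnW// ltn_expl.
have : `|c| < n%:R * d by rewrite -ltr_pdivrMr.
have := ler_norm c; have : n%:R * d <= (2 ^ n)%:R * d by rewrite ler_pM2r.
lra.
Qed.

Section one.
Variable f : A -> A.
Hypothesis hf : is_star_automorphism f.

Lemma autD : {morph f : x y / x + y}.
Proof. by case: hf => h _ _ _ x y; have := h 1 x y; rewrite !scale1r. Qed.

Lemma aut0 : f 0 = 0.
Proof. by apply: (addrI (f 0)); rewrite -autD !addr0. Qed.

Lemma autZ (c : R[i]) x : f (c *: x) = c *: f x.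
Proof. by case: hf => h _ _ _; have := h c x 0; rewrite !addr0 aut0 addr0. Qed.

Lemma autN x : f (- x) = - f x.
Proof. by rewrite -scaleN1r autZ scaleN1r. Qed.

Lemma autB x y : f (x - y) = f x - f y.
Proof. by rewrite autD autN. Qed.

Lemma autM x y : f (x * y) = f x * f y.
Proof. by case: hf => _ [] _ h _ _; exact: h. Qed.

Lemma aut1 : f 1 = 1.
Proof. by case: hf => _ [] h _ _ _; exact: h. Qed.

Lemma aut_star x : f (star x) = star (f x).
Proof. by case: hf => _ _ h _; exact: h. Qed.

Lemma aut_unitary u : is_unitary u -> is_unitary (f u).
Proof. by case=> h1 h2; split; rewrite -aut_star -autM (h1, h2) aut1. Qed.

(** No continuity of [f] is assumed: a self-adjoint element of norm at most 1/5 is the mean of a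
    unitary and its adjoint, and [f] preserves unitaries. The factor 5 is that of the scaling. *)
Lemma aut_sa_bound h : star h = h -> N (f h) <= 5 * N h.
Proof.
move=> sh; have [->|h0] := eqVneq h 0; first by rewrite aut0 rnorm0 mulr0.
have Nh : 0 < N h by rewrite lt_def rnorm_eq0 h0 rnorm_ge0.
pose r := (5 * N h)^-1.
have r0 : 0 < r by rewrite invr_gt0 mulr_gt0.
have [|||u [uu _ hu]] := @unitary_dilation _ _ (r%:C *: h) _ (setT_subalgebra A).
- by [].
- by rewrite starZr sh.
- by rewrite rnormZ gtr0_norm// /r invfM -mulrA mulVf ?gt_eqF// mulr1.
have : N (f (r%:C *: h)) <= 1.
  rewrite hu autZ autD aut_star rnorm_half.
  have := unitary_norm (aut_unitary uu) => e.
  have := rnormD (f u) (star (f u)); rewrite rnorm_star e; lra.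
by rewrite autZ rnormZ gtr0_norm// /r mulrC ler_pdivrMr ?mulr_gt0// mul1r.
Qed.

Lemma rnorm_sa_pow h n : star h = h ->
  star (h ^+ (2 ^ n)) = h ^+ (2 ^ n) /\ N (h ^+ (2 ^ n)) = N h ^+ (2 ^ n).
Proof.
move=> sh; elim: n => [|n [IHs IHn]]; first by rewrite expn0 !expr1.
rewrite expnS mulnC !exprM !expr2 star_mul IHs; split => //.
by rewrite -{1}IHs rnorm_starM IHn expr2.
Qed.

Lemma aut_pow h n : f (h ^+ n) = f h ^+ n.
Proof. by elim: n => [|n IH]; rewrite ?expr0 ?aut1// !exprS autM IH. Qed.

(* Boundedness of [f] on self-adjoint elements improves to contractivity, as
   [N (h ^ 2^n) = (N h) ^ 2^n]. *)
Lemma aut_contractive x : N (f x) <= N x.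
Proof.
have sa h : star h = h -> N (f h) <= N h.
  move=> sh; apply: (@le_of_pow _ _ 5) (rnorm_ge0 _) (rnorm_ge0 _) _ => n.
  have sfh : star (f h) = f h by rewrite -aut_star sh.
  have [s1 n1] := rnorm_sa_pow n sh; have [s2 n2] := rnorm_sa_pow n sfh.
  by rewrite -n1 -n2 -aut_pow aut_sa_bound.
(* The C*-identity reduces the general case to the self-adjoint [star x * x]. *)
rewrite -(@ler_pXn2r _ 2) ?nnegrE ?rnorm_ge0// -!rnorm_starM -aut_star -autM.
by apply: sa; rewrite star_mul starK.
Qed.

End one.
End Contractive.

(** * Invariant means over the unitary group *)

Section RealBasis.
Variables (R : realType) (A : unitalCStarType R) (D : set A).
Implicit Types (x y z : A).
Local Notation N := (@rnorm R A).
Local Open Scope complex_scope.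

(** [D] is treated as a real space, on which the conjugate-linear [star] becomes linear. *)
Definition rlc m (f : 'I_m -> A) (c : 'I_m -> R) : A :=
  \sum_i (c i)%:C *: f i.

Lemma rlcD m (f : 'I_m -> A) c d :
  rlc f (fun i => c i + d i) = rlc f c + rlc f d.
Proof.
by rewrite /rlc -big_split; apply: eq_bigr => i _; rewrite rmorphD scalerDl.
Qed.

Lemma rlcZ m (f : 'I_m -> A) c a :
  rlc f (fun i => a * c i) = a%:C *: rlc f c.
Proof.
by rewrite /rlc scaler_sumr; apply: eq_bigr => i _; rewrite rmorphM scalerA.
Qed.

Lemma rlcB m (f : 'I_m -> A) c d :
  rlc f (fun i => c i - d i) = rlc f c - rlc f d.
Proof.
rewrite /rlc -sumrB; apply: eq_bigr => i _.
by rewrite rmorphB scalerBl.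
Qed.

Definition real_span m (f : 'I_m -> A) : Prop :=
  forall x, D x <-> exists c, x = rlc f c.

Definition real_indep m (f : 'I_m -> A) : Prop :=
  forall c, rlc f c = 0 -> forall i, c i = 0.

Lemma real_span_mem m (f : 'I_m -> A) i : real_span f -> D (f i).
Proof.
move=> fD; apply/fD; exists (fun j => (i == j)%:R).
rewrite /rlc (bigD1 i)//= eqxx rmorph1 scale1r big1 ?addr0// => j ij.
by rewrite eq_sym (negbTE ij) rmorph0 scale0r.
Qed.

Lemma finite_dimensional_real_span : finite_dimensional D ->
  exists m (f : 'I_m -> A), real_span f.
Proof.
move=> [n [e De]]; exists (n + n)%N, (fun j : 'I_(n + n) =>
  match fintype.split j with inl i => e i | inr i => 'i *: e i end).
move=> x; rewrite De; split=> -[c ->].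
  exists (fun j : 'I_(n + n) => match fintype.split j with
    inl i => complex.Re (c i) | inr i => complex.Im (c i) end).
  rewrite /rlc big_split_ord /= -big_split; apply: eq_bigr => i _ /=.
  have -> : fintype.split (lshift n i) = inl i by exact: (unsplitK (inl i)).
  have -> : fintype.split (rshift n i) = inr i by exact: (unsplitK (inr i)).
  by rewrite scalerA -scalerDl [in LHS](complexE (c i)) mulrC.
exists (fun i => (c (lshift n i))%:C + 'i * (c (rshift n i))%:C).
rewrite /rlc big_split_ord /= -big_split; apply: eq_bigr => i _ /=.
have -> : fintype.split (lshift n i) = inl i by exact: (unsplitK (inl i)).
have -> : fintype.split (rshift n i) = inr i by exact: (unsplitK (inr i)).
by rewrite scalerA -scalerDl mulrC.
Qed.

(** A spanning family of minimal length is independent, since a nontrivial relation would make one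
    of its members redundant. *)
Lemma real_span_basis m (f : 'I_m -> A) : real_span f ->
  exists n (g : 'I_n -> A), real_span g /\ real_indep g.
Proof.
pose Q n := `[< exists g : 'I_n -> A, real_span g >].
move=> fD; have exQ : exists n, Q n by exists m; apply/asboolP; exists f.
case: (ex_minnP exQ) => n /asboolP[g gD] nmin; exists n, g; split => // c c0 i.
apply: contrapT => /eqP ci.
case: n => [|n] in g gD nmin c c0 i ci *; first by case: i {ci}.
suff : Q n by move=> /nmin; rewrite ltnn.
apply/asboolP; exists (fun j => g (lift i j)) => x; rewrite gD.
have gi : g i = rlc (fun j => g (lift i j)) (fun j => - (c i)^-1 * c (lift i j)).
  move: c0; rewrite /rlc (bigD1_ord i)//= => /eqP; rewrite addr_eq0 => /eqP h.
  have -> : g i = ((c i)^-1)%:C *: ((c i)%:C *: g i).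
    by rewrite scalerA -rmorphM mulVf// scale1r.
  rewrite h scalerN -scaleNr -rmorphN scaler_sumr; apply: eq_bigr => j _.
  by rewrite scalerA -rmorphM.
split=> -[d ->].
  exists (fun j => d i * (- (c i)^-1 * c (lift i j)) + d (lift i j)).
  by rewrite rlcD rlcZ -gi {1}/rlc (bigD1_ord i).
exists (fun j => oapp d 0 (unlift i j)).
rewrite /rlc (bigD1_ord i)//= unlift_none /= scale0r add0r.
by apply: eq_bigr => j _; rewrite liftK.
Qed.

(** Equivalence of norms: the norm of the combination attains a minimum on the compact unit sphere
    of coefficients, and independence makes it positive. *)
Lemma real_indep_bound m (f : 'I_m -> A) : real_indep f ->
  exists2 B, 0 < B & forall c i, `|c i| <= B * N (rlc f c).
Proof.
move=> fI.
pose S := [set c : 'rV[R]_m | `|c| = 1].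
pose F (c : 'rV[R]_m) := rlc f (fun i => c 0 i).
have le_norm (c : 'rV[R]_m) i : `|c 0 i| <= `|c|.
  by rewrite [leRHS]/Num.Def.normr /= mx_normrE; apply/bigmax_geP; right => /=; exists (0, i).
have cF : continuous (fun c => N (F c)).
  move=> c; apply: (@cvg_rnorm _ _ _ (nbhs c) _ F (F c)).
  apply: (@cvg_rnorm_le _ _ _ (nbhs c) _ _ _ (fun d => `|d - c| * \sum_i N (f i))).
    near=> d; rewrite /F -rlcB (le_trans (rnorm_sum _ _ _))// mulr_sumr.
    apply: ler_sum => i _; rewrite rnormZ ler_wpM2r ?rnorm_ge0//.
    by have := le_norm (d - c) i; rewrite !mxE.
  move: (\sum_i N (f i)) => K.
  rewrite -(mul0r K); apply: cvgM; last exact: cvg_cst.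
  rewrite -(@normr0 _ 'rV[R]_m) -(subrr c).
  by apply: cvg_norm; apply: cvgB; [exact: cvg_id|exact: cvg_cst].
have cS : compact S.
  apply: bounded_closed_compact.
    by exists 1; split => // M M1 c /= ->; exact: ltW.
  have -> : S = (fun c : 'rV[R]_m => `|c|) @^-1` [set 1] by [].
  apply: closed_comp => [c _|]; first exact: norm_continuous.
  exact: closed_eq.
have FZ a c : F (a *: c) = a%:C *: F c.
  by rewrite /F -rlcZ; congr (rlc f _); apply/funext => i; rewrite mxE.
have toS (c : 'rV[R]_m) : c != 0 -> S (`|c|^-1 *: c).
  by move=> c0; rewrite /S /= normrZ normfV normr_id mulVf// normr_eq0.
(* If the sphere is empty, as for [m = 0], all coefficients vanish and any bound works. *)
have [[c0 Sc0]|S0] := pselect (exists c, S c); last first.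
  exists 1 => // c i; suff -> : c i = 0 by rewrite normr0 mul1r rnorm_ge0.
  have [e|e] := eqVneq (\row_i c i) 0; last by case: S0; eexists; exact: toS e.
  by have := congr1 (fun v : 'rV[R]_m => v 0 i) e; rewrite !mxE.
have [d Sd dmin] : exists2 d, d \in S & forall t, t \in S -> N (F d) <= N (F t).
  by apply: EVT_min_rV => //; [exists c0|exact: continuous_subspaceT].
move: Sd; rewrite inE => Sd.
have mu0 : 0 < N (F d).
  rewrite lt_def rnorm_ge0 andbT rnorm_eq0; apply/eqP => /fI d0.
  have : d = 0 by apply/rowP => i; rewrite d0 mxE.
  by move=> e; move: Sd; rewrite /S /= e normr0 => /esym/eqP; rewrite oner_eq0.
exists (N (F d))^-1; first by rewrite invr_gt0.
move=> c i; rewrite ler_pdivlMl//.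
pose r : 'rV[R]_m := \row_i c i.
have rE : F r = rlc f c by congr (rlc f _); apply/funext => j; rewrite mxE.
have [r0|r0] := eqVneq r 0.
  have -> : c i = 0 by have := congr1 (fun v : 'rV[R]_m => v 0 i) r0; rewrite !mxE.
  by rewrite normr0 mulr0 rnorm_ge0.
have rp : 0 < `|r| by rewrite normr_gt0.
have := dmin (`|r|^-1 *: r); rewrite inE => /(_ (toS _ r0)).
rewrite FZ rnormZ rE normfV normr_id ler_pdivlMl// mulrC; apply: le_trans.
by rewrite ler_pM2l//; have := le_norm r i; rewrite mxE.
Unshelve. all: by end_near. Qed.

End RealBasis.

(** * Fixed points of bounded linear groups on convex sets of matrices *)

Section FixedPoint.
Variables (R : realType) (m n : nat).
Local Notation V := 'M[R]_(m, n).
Implicit Types (k l : V) (g h : V -> V).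

Definition sqnorm k : R := \sum_i \sum_j k i j ^+ 2.

Definition entrywise_cvg (a : nat -> V) k : Prop :=
  forall i j, (fun p => a p i j) @ \oo --> k i j.

Lemma sqnorm_ge0 k : 0 <= sqnorm k.
Proof. by apply: sumr_ge0 => i _; apply: sumr_ge0 => j _; exact: sqr_ge0. Qed.

Lemma entry_le_sqnorm k i j : k i j ^+ 2 <= sqnorm k.
Proof.
rewrite /sqnorm (bigD1 i)//= (bigD1 j)//= -addrA lerDl addr_ge0//.
  by apply: sumr_ge0 => *; exact: sqr_ge0.
by apply: sumr_ge0 => *; apply: sumr_ge0 => *; exact: sqr_ge0.
Qed.

Lemma sqnorm_eq0 k : sqnorm k <= 0 -> k = 0.
Proof.
move=> h; apply/matrixP => i j; rewrite mxE; apply/eqP; rewrite -sqrf_eq0.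
by rewrite eq_le sqr_ge0 andbT (le_trans (entry_le_sqnorm k i j)).
Qed.

(** The parallelogram law; its last term is the source of uniform convexity. *)
Lemma sqnorm_midpoint k l :
  sqnorm (2^-1 *: (k + l)) =
    2^-1 * sqnorm k + 2^-1 * sqnorm l - 4^-1 * sqnorm (k - l).
Proof.
rewrite /sqnorm !mulr_sumr -big_split -sumrB; apply: eq_bigr => i _ /=.
rewrite !mulr_sumr -big_split -sumrB; apply: eq_bigr => j _ /=.
by rewrite !mxE; field.
Qed.

Lemma sqnormD k l : sqnorm (k + l) <= 2 * sqnorm k + 2 * sqnorm l.
Proof.
rewrite /sqnorm !mulr_sumr -big_split; apply: ler_sum => i _ /=.
rewrite !mulr_sumr -big_split; apply: ler_sum => j _ /=.
by rewrite !mxE; have := sqr_ge0 (k i j - l i j); lra.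
Qed.

Lemma sqnormC k l : sqnorm (k - l) = sqnorm (l - k).
Proof.
by apply: eq_bigr => i _; apply: eq_bigr => j _; rewrite !mxE -sqrrN opprB.
Qed.

Lemma entrywise_cvg_sqnorm (a : nat -> V) k l c : entrywise_cvg a k ->
  (\forall p \near \oo, sqnorm (a p - l) <= c) -> sqnorm (k - l) <= c.
Proof.
move=> ak h; apply: (cvgr_to_le _ h); rewrite /sqnorm.
apply: cvg_big => [|i _]; first exact: add_continuous.
apply: cvg_big => [|j _]; first exact: add_continuous.
rewrite (_ : (fun x => _) = fun x => (a x i j - l i j) ^+ 2); last first.
  by apply/funext => x; rewrite !mxE.
rewrite !mxE; apply: (@cvg_comp _ _ _ _ (fun x : R => x ^+ 2) _ (nbhs (k i j - l i j))).
  by apply: cvgB; [exact: ak|exact: cvg_cst].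
exact: exprn_continuous.
Qed.

Lemma sqnorm_cauchy_cvg (a : nat -> V) (c : R) :
  (forall p q, (p <= q)%N -> sqnorm (a q - a p) <= (c * 2^-1 ^+ p) ^+ 2) ->
  0 <= c -> exists k, entrywise_cvg a k.
Proof.
move=> ha c0.
have ca i j : cvg ((fun p => a p i j) @ \oo).
  apply: cauchy_cvg; apply: cauchy_exP => e e0.
  have /cvgrPdist_lt/(_ _ e0)[p _ hp] := cvg_half_pow c.
  exists (a p i j), p => // q /= pq; rewrite -ball_normE /ball_ /=.
  have := hp p (leqnn p); rewrite /= sub0r normrN; apply: le_lt_trans.
  rewrite -ler_sqr ?nnegrE// !real_normK ?num_real//.
  apply: le_trans (ha _ _ pq).
  by have := entry_le_sqnorm (a q - a p) i j; rewrite !mxE -sqrrN opprB.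
by exists (\matrix_(i, j) lim ((fun p => a p i j) @ \oo)) => i j; rewrite mxE.
Qed.

(* A bounded group of linear maps preserves [k |-> sup_g |g k|^2], which is
   uniformly convex; the minimizer of this function is hence a fixed point. *)
Lemma uniformly_bounded_fixed_point (G : set (V -> V)) (K : set V) (C : R) :
  G id ->
  (forall g h, G g -> G h -> G (g \o h)) ->
  (forall g, G g -> exists2 h, G h & forall k, h (g k) = k) ->
  (forall g, G g -> linear g) ->
  (forall g k, G g -> sqnorm (g k) <= C * sqnorm k) ->
  K !=set0 ->
  (forall k l, K k -> K l -> K (2^-1 *: (k + l))) ->
  (forall g k, G g -> K k -> K (g k)) ->
  (forall a k, entrywise_cvg a k -> (forall p, K (a p)) -> K k) ->
  exists2 k, K k & forall g, G g -> g k = k.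
Proof.
move=> Gid Gcomp Ginv Glin Gb [k0 Kk0] Kmid Kg Kcl.
have GB g k l : G g -> g (k - l) = g k - g l.
  by move=> /Glin gl; rewrite addrC -scaleN1r gl scaleN1r addrC.
have GM g k l : G g -> g (2^-1 *: (k + l)) = 2^-1 *: (g k + g l).
  move=> /Glin gl; have g0 : g 0 = 0.
    by have := gl (-1) 0 0; rewrite scaler0 addr0 scaleN1r addNr.
  have -> : 2^-1 *: (k + l) = 2^-1 *: (1 *: k + l) + 0 by rewrite scale1r addr0.
  by rewrite gl gl g0 addr0 scale1r.
wlog C1 : C Gb / 1 <= C => [hC|].
  apply: (hC (Num.max C 1)); last by rewrite le_max lexx orbT.
  move=> g k Gg; apply: le_trans (Gb g k Gg) _.
  by rewrite ler_wpM2r ?sqnorm_ge0// le_max lexx.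
have C0 : 0 < C by apply: lt_le_trans C1.
pose S k := [set sqnorm (g k) | g in G].
pose M k := sup (S k).
have Sb k : has_sup (S k).
  split; first by exists (sqnorm k), id.
  by exists (C * sqnorm k) => _ [g Gg <-]; exact: Gb.
have leM g k : G g -> sqnorm (g k) <= M k.
  by move=> Gg; apply: ub_le_sup; [case: (Sb k)|exists g].
have Mle k c : (forall g, G g -> sqnorm (g k) <= c) -> M k <= c.
  by move=> h; apply: ge_sup => [|_ [g Gg <-]]; [case: (Sb k)|exact: h].
have M0 k : 0 <= M k by apply: le_trans (leM id k Gid); exact: sqnorm_ge0.
have MG g k : G g -> M (g k) <= M k.
  by move=> Gg; apply: Mle => h Gh; apply: (leM (h \o g)); exact: Gcomp.
have low g k : G g -> sqnorm k <= C * sqnorm (g k).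
  by move=> /Ginv[h Gh hg]; rewrite -{1}(hg k); exact: Gb.
(* The inverses are bounded as well, so [sqnorm (g (k - l))] is at least [C^-1 * sqnorm (k - l)] for
   all [g] in [G] at once; the gain in the parallelogram law thus survives the supremum. *)
have Mmid k l :
    4^-1 * sqnorm (k - l) <= C * (2^-1 * M k + 2^-1 * M l - M (2^-1 *: (k + l))).
  suff : M (2^-1 *: (k + l)) <= 2^-1 * M k + 2^-1 * M l - C^-1 * (4^-1 * sqnorm (k - l)).
    by rewrite -ler_pdivrMl//; lra.
  apply: Mle => g Gg; rewrite GM// sqnorm_midpoint -GB//.
  have := leM g k Gg; have := leM g l Gg.
  have : C^-1 * sqnorm (k - l) <= sqnorm (g (k - l)) by rewrite ler_pdivrMl//; exact: low.
  lra.
pose I := inf [set M k | k in K].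
have hI : has_inf [set M k | k in K].
  by split; [exists (M k0), k0|exists 0 => _ [k _ <-]].
have IM k : K k -> I <= M k.
  by move=> Kk; apply: ge_inf; [case: hI|exists k].
(* The midpoint stays in [K], so [M] cannot drop below [I] there; almost minimizers are therefore
   close to each other. *)
have near_min k l e : K k -> K l -> M k <= I + e -> M l <= I + e ->
    sqnorm (k - l) <= 4 * C * e.
  move=> Kk Kl ke le; have := IM _ (Kmid _ _ Kk Kl); have := Mmid k l => h1 h2.
  have h3 : C * (2^-1 * M k + 2^-1 * M l - M (2^-1 *: (k + l))) <= C * e.
    by rewrite ler_pM2l//; lra.
  lra.
(* A square, so that the distances, which are square roots of [sqnorm], decay geometrically. *)
pose e (p : nat) : R := (2^-1 ^+ p) ^+ 2.
have e0 p : 0 < e p by rewrite /e !exprn_gt0// invr_gt0.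
have /choice[a aP] : forall p, exists k, K k /\ M k <= I + e p.
  move=> p; have [_ [k Kk <-] ke] := inf_adherent (e0 p) hI.
  by exists k; split => //; exact: ltW.
have ep p q : (p <= q)%N -> e q <= e p.
  move=> pq; rewrite /e lerXn2r ?nnegrE ?exprn_ge0 ?invr_ge0//.
  by rewrite ler_wiXn2l ?invr_ge0// invf_le1// ler1n.
have aa p q : (p <= q)%N -> sqnorm (a q - a p) <= 4 * C * e p.
  move=> pq; have [Kp Mp] := aP p; have [Kq Mq] := aP q; apply: near_min => //.
  by apply: le_trans Mq _; rewrite lerD2l ep.
have ca p q : (p <= q)%N ->
    sqnorm (a q - a p) <= (2 * Num.sqrt C * 2^-1 ^+ p) ^+ 2.
  move=> pq; apply: le_trans (aa _ _ pq) _.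
  have -> : 4 = 2 ^+ 2 :> R by rewrite -natrX.
  by rewrite /e [leRHS]exprMn [(2 * _) ^+ 2]exprMn sqr_sqrtr; [exact: lexx|exact: ltW].
have [k ak] := sqnorm_cauchy_cvg ca (mulr_ge0 (ler0n R 2) (sqrtr_ge0 C)).
have Kk : K k by apply: Kcl ak _ => p; case: (aP p).
exists k => // g Gg; apply/eqP; rewrite -subr_eq0; apply/eqP/sqnorm_eq0.
have ka p : sqnorm (k - a p) <= 4 * C * e p.
  by apply: entrywise_cvg_sqnorm ak _; exists p => // q /=; exact: aa.
(* [M] does not increase under [G], so [g (a p)] is as nearly minimal as [a p] and hence close to
   it; [g k - k] is compared with their difference. *)
have gk p : sqnorm (g k - k) <= (8 * C + 16 * (C + C * C)) * e p.
  have -> : g k - k = (g (a p) - a p) + (g (k - a p) + (a p - k)).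
    by rewrite (GB g k (a p) Gg); apply/matrixP => i j; rewrite !mxE; ring.
  have [Kp Mp] := aP p.
  have h1 : sqnorm (g (a p) - a p) <= 4 * C * e p.
    by apply: near_min => //; [exact: Kg|exact: le_trans (MG _ _ Gg) Mp].
  have h2 := Gb g (k - a p) Gg; have h3 := ka p.
  have h4 := sqnormC (a p) k.
  have h5 := sqnormD (g (a p) - a p) (g (k - a p) + (a p - k)).
  have h6 := sqnormD (g (k - a p)) (a p - k).
  have h7 : C * sqnorm (k - a p) <= C * (4 * C * e p) by rewrite ler_pM2l.
  lra.
have ce : (fun p => (8 * C + 16 * (C + C * C)) * e p) @ \oo --> (0 : R).
  rewrite -(mulr0 (8 * C + 16 * (C + C * C))); apply: cvgM; first exact: cvg_cst.
  rewrite /e (_ : 0 = 0 ^+ 2 :> R); last by rewrite expr0n.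
  apply: (@cvg_comp _ _ _ _ (fun x : R => x ^+ 2) _ (nbhs (0 : R))).
    have := @cvg_half_pow R 1; under eq_fun do rewrite mul1r; exact.
  exact: exprn_continuous.
by apply: (cvgr_to_ge ce); near=> p; exact: gk.
Unshelve. all: by end_near. Qed.

End FixedPoint.

(** * Tensors over the subalgebra and the action of its unitaries *)

Section Mean.
Variables (R : realType) (A : unitalCStarType R) (D : set A).
Hypothesis hD : is_unital_cstar_subalgebra D.
Implicit Types (x y z v w : A) (F : A -> A -> A) (P : A -> Prop).
Local Notation N := (@rnorm R A).
Local Open Scope complex_scope.

Definition rlinear_on (f : A -> A) : Prop :=
  forall (a : R) x y, D x -> D y -> f (a%:C *: x + y) = a%:C *: f x + f y.

Definition rbilinear_on F : Prop :=
  (forall y, D y -> rlinear_on (F ^~ y)) /\ (forall x, D x -> rlinear_on (F x)).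

Definition midconvex P : Prop :=
  forall x y, P x -> P y -> P (2^-1 *: (x + y)).

Lemma rlinear_on_rlc (f : A -> A) m (b : 'I_m -> A) c :
  rlinear_on f -> (forall i, D (b i)) ->
  f (rlc b c) = \sum_i (c i)%:C *: f (b i).
Proof.
move=> hf Db.
have f0 : f 0 = 0.
  by have := hf (-1) 0 0 (suba0 hD) (suba0 hD); rewrite scaler0 addr0 rmorphN1 scaleN1r addNr.
suff [//] : D (rlc b c) /\ f (rlc b c) = \sum_i (c i)%:C *: f (b i).
rewrite /rlc; elim/big_ind2: _ => [|x x' y y' [Dx <-] [Dy <-]|i _].
- by split => //; exact: suba0.
- split; first exact: subaD.
  by have := hf 1 x' y' Dx Dy; rewrite rmorph1 !scale1r.
- split; first exact: subaZ.
  by have := hf (c i) (b i) 0 (Db i) (suba0 hD); rewrite !addr0 f0 addr0.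
Qed.

Section basis.
Variables (m : nat) (b : 'I_m -> A).
Hypothesis bD : real_span D b.
Hypothesis bI : real_indep b.

Let Db i : D (b i).
Proof. exact: (@real_span_mem _ _ _ _ _ i bD). Qed.

Definition coord x : 'I_m -> R :=
  if pselect (exists c, x = rlc b c) is left h then projT1 (cid h) else fun=> 0.

Lemma coordK x : D x -> x = rlc b (coord x).
Proof.
move=> /bD h; rewrite /coord; case: pselect => // h'.
exact: (projT2 (cid h')).
Qed.

Lemma rlc_inj c d : rlc b c = rlc b d -> c = d.
Proof.
move=> cd; apply/funext => i; apply/eqP; rewrite -subr_eq0; apply/eqP.
by apply: (bI (c := fun i => c i - d i)); rewrite rlcB cd subrr.
Qed.

Lemma coordD x y a i : D x -> D y ->
  coord (a%:C *: x + y) i = a * coord x i + coord y i.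
Proof.
move=> Dx Dy; have Dxy : D (a%:C *: x + y) by apply: subaD => //; exact: subaZ.
have := coordK Dxy; rewrite {1}(coordK Dx) {1}(coordK Dy) -rlcZ -rlcD.
by move=> /rlc_inj <-.
Qed.

(** [k] encodes the tensor with coefficients [k i j] on [b i (x) b j]; this is its image under the
    linear map that [F] induces. *)
Definition avg (k : 'M[R]_m) F : A :=
  \sum_i \sum_j (k i j)%:C *: F (b i) (b j).

Lemma bilinear_expand F x y : rbilinear_on F -> D x -> D y ->
  F x y = \sum_i \sum_j (coord x i * coord y j)%:C *: F (b i) (b j).
Proof.
move=> [F1 F2] Dx Dy.
rewrite {1}(coordK Dx) (rlinear_on_rlc _ (F1 y Dy) Db).
apply: eq_bigr => i _; rewrite {1}(coordK Dy) (rlinear_on_rlc _ (F2 _ (Db i)) Db).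
by rewrite scaler_sumr; apply: eq_bigr => j _; rewrite rmorphM scalerA.
Qed.

(** The map [x (x) y |-> w x (x) y w^*] of tensors, in coordinates. *)
Definition act w (k : 'M[R]_m) : 'M[R]_m := \matrix_(i, j)
  \sum_s \sum_t k s t * (coord (w * b s) i * coord (b t * star w) j).

Lemma avg_act w k F : D w -> rbilinear_on F ->
  avg (act w k) F = avg k (fun x y => F (w * x) (y * star w)).
Proof.
move=> Dw bF; rewrite /avg.
transitivity (\sum_i \sum_j \sum_s \sum_t (k s t)%:C *:
    ((coord (w * b s) i * coord (b t * star w) j)%:C *: F (b i) (b j))).
  apply: eq_bigr => i _; apply: eq_bigr => j _; rewrite mxE rmorph_sum scaler_suml.
  apply: eq_bigr => s _; rewrite rmorph_sum scaler_suml.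
  by apply: eq_bigr => t _; rewrite rmorphM scalerA.
under eq_bigr do rewrite exchange_big; rewrite exchange_big; apply: eq_bigr => s _.
under eq_bigr do rewrite exchange_big; rewrite exchange_big; apply: eq_bigr => t _.
rewrite (bilinear_expand bF); last 2 first.
- exact: subaM.
- by apply: subaM => //; exact: suba_star.
rewrite scaler_sumr; apply: eq_bigr => i _; rewrite scaler_sumr.
exact: eq_bigr.
Qed.

Definition unit_form i j x y : A := (coord x i * coord y j)%:C *: 1.

Lemma unit_form_bilinear i j : rbilinear_on (unit_form i j).
Proof.
split=> z Dz a x y Dx Dy; rewrite /unit_form coordD// scalerA -scalerDl -rmorphM -rmorphD.
  by congr (_%:C *: _); ring.
by congr (_%:C *: _); ring.
Qed.

Lemma coord_basis i j : coord (b i) j = (i == j)%:R.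
Proof.
have /rlc_inj <- // : rlc b (fun j => (i == j)%:R) = rlc b (coord (b i)).
rewrite -(coordK (Db i)) /rlc (bigD1 i)//= eqxx rmorph1 scale1r big1 ?addr0// => k ik.
by rewrite eq_sym (negbTE ik) rmorph0 scale0r.
Qed.

Lemma avg_unit_form k i j : avg k (unit_form i j) = (k i j)%:C *: 1.
Proof.
rewrite /avg (bigD1 i)//= (bigD1 j)//= /unit_form !coord_basis !eqxx mulr1.
rewrite rmorph1 scale1r big1 ?addr0 => [|s sj]; last first.
  by rewrite !coord_basis (negbTE sj) mulr0 rmorph0 scale0r scaler0.
rewrite big1 ?addr0// => s si; apply: big1 => t _.
by rewrite !coord_basis (negbTE si) mul0r rmorph0 scale0r scaler0.
Qed.

(** The forms [unit_form i j] recover the entries. The laws of the action can hence be checked on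
    averages, where they reduce to associativity. *)
Lemma avg_inj k l : (forall F, rbilinear_on F -> avg k F = avg l F) -> k = l.
Proof.
move=> h; apply/matrixP => i j.
have := h _ (unit_form_bilinear i j); rewrite !avg_unit_form => /eqP.
rewrite -subr_eq0 -scalerBl -rmorphB scaler_eq0 oner_eq0 orbF.
by rewrite (inj_eq (@complexI R) _ 0) subr_eq0 => /eqP.
Qed.

Lemma bilinear_conj F w : D w -> rbilinear_on F ->
  rbilinear_on (fun x y => F (w * x) (y * star w)).
Proof.
move=> Dw [F1 F2]; have Dw' := suba_star hD Dw.
split=> z Dz a x y Dx Dy.
  by rewrite mulrDr -scalerAr F1//; exact: subaM.
by rewrite mulrDl -scalerAl F2//; exact: subaM.
Qed.

Lemma act_comp w w' k : D w -> D w' -> act w (act w' k) = act (w * w') k.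
Proof.
move=> Dw Dw'; apply: avg_inj => F bF.
have Dww : D (w * w') by exact: subaM.
rewrite !avg_act//; last exact: bilinear_conj.
by apply: eq_bigr => i _; apply: eq_bigr => j _; rewrite star_mul !mulrA.
Qed.

Lemma act1 k : act 1 k = k.
Proof.
apply: avg_inj => F bF; rewrite avg_act//; last exact: suba1.
by apply: eq_bigr => i _; apply: eq_bigr => j _; rewrite star1 mulr1 mul1r.
Qed.

Lemma act_linear w : linear (act w).
Proof.
move=> a k l; apply/matrixP => i j; rewrite !mxE mulr_sumr -big_split.
apply: eq_bigr => s _; rewrite mulr_sumr -big_split; apply: eq_bigr => t _ /=.
by rewrite !mxE; ring.
Qed.

(** Coordinates are bounded by the norm, which multiplication by a unitary does not increase. The
    constant depends on [D], but only feeds the fixed point theorem. *)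
Lemma act_bounded : exists C, forall w k, D w -> is_unitary w ->
  sqnorm (act w k) <= C * sqnorm k.
Proof.
have [B B0 hB] := real_indep_bound bI.
pose T := \sum_s \sum_t (B * N (b s)) * (B * N (b t)).
exists (\sum_(i < m) \sum_(j < m) T ^+ 2) => w k Dw uw.
rewrite mulr_suml; apply: ler_sum => i _; rewrite mulr_suml; apply: ler_sum => j _.
have T0 : 0 <= T.
  by apply: sumr_ge0 => s _; apply: sumr_ge0 => t _; rewrite !mulr_ge0 ?rnorm_ge0// ltW.
have -> : T ^+ 2 * sqnorm k = (T * Num.sqrt (sqnorm k)) ^+ 2.
  by rewrite exprMn sqr_sqrtr ?sqnorm_ge0.
rewrite -real_normK ?num_real// ler_sqr ?nnegrE ?mulr_ge0 ?sqrtr_ge0//.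
rewrite mxE (le_trans (ler_norm_sum _ _ _))// mulr_suml; apply: ler_sum => s _.
rewrite (le_trans (ler_norm_sum _ _ _))// mulr_suml; apply: ler_sum => t _.
rewrite normrM mulrC ler_pM// ?normrM.
  have D1 : D (w * b s) by exact: subaM.
  have D2 : D (b t * star w) by apply: subaM => //; exact: suba_star.
  have Nw := unitary_norm uw.
  rewrite ler_pM//.
    apply: le_trans (hB _ _) _; rewrite -coordK// ler_pM2l//.
    by apply: rnormM1l; rewrite ?Nw.
  apply: le_trans (hB _ _) _; rewrite -coordK// ler_pM2l//.
  by apply: rnormM1r; rewrite ?rnorm_star ?Nw.
by rewrite -sqrtr_sqr ler_wsqrtr// entry_le_sqnorm.
Qed.

(* The closed convex hull of the tensors [v (x) v^*], [v] unitary in [D], in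
   terms of the averages that they define. *)
Definition avg_hull : set 'M[R]_m := [set k | forall F P, rbilinear_on F ->
  midconvex P -> seq_closed P ->
  (forall v, D v -> is_unitary v -> P (F v (star v))) -> P (avg k F)].

Lemma invariant_avg : exists2 k, avg_hull k &
  forall w F, D w -> is_unitary w -> rbilinear_on F ->
    avg k (fun x y => F (w * x) (y * star w)) = avg k F.
Proof.
have [C hC] := act_bounded.
pose G := [set g | exists w, [/\ D w, is_unitary w & g = act w]].
have [|||||||||] := @uniformly_bounded_fixed_point R m m G avg_hull C.
- exists 1; split; [exact: suba1|exact: unitary1|].
  by apply/funext => k; rewrite act1.
- move=> _ _ [w [Dw uw ->]] [w' [Dw' uw' ->]]; exists (w * w'); split.
  + exact: subaM.
  + exact: unitaryM.
  + by apply/funext => k /=; rewrite act_comp.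
- move=> _ [w [Dw uw ->]]; have Dw' := suba_star hD Dw.
  exists (act (star w)); first by exists (star w); split => //; exact: unitary_star.
  by move=> k; rewrite act_comp//; case: uw => -> _; exact: act1.
- by move=> _ [w [Dw uw ->]]; exact: act_linear.
- by move=> _ k [w [Dw uw ->]]; exact: hC.
(* The tensor [1 (x) 1] of the unitary [v = 1] shows that the hull is not empty. *)
- exists (\matrix_(i, j) (coord 1 i * coord 1 j)) => F P bF _ _ h.
  have := h 1 (suba1 hD) (unitary1 A); rewrite star1 (bilinear_expand bF); last 2 first.
  + exact: suba1.
  + exact: suba1.
  by rewrite /avg; under [X in _ -> P X]eq_bigr do under eq_bigr do rewrite mxE.
- move=> k l Kk Kl F P bF mP cP h.
  have -> : avg (2^-1 *: (k + l)) F = 2^-1 *: (avg k F + avg l F).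
    rewrite half_realE.
    rewrite /avg -big_split scaler_sumr; apply: eq_bigr => i _ /=.
    rewrite -big_split scaler_sumr; apply: eq_bigr => j _ /=.
    by rewrite -scalerDl scalerA !mxE -rmorphD -rmorphM.
  by apply: (mP); [exact: Kk|exact: Kl].
- move=> _ k [w [Dw uw ->]] Kk F P bF mP cP h.
  rewrite avg_act//; apply: Kk => //; first exact: bilinear_conj.
  move=> v Dv uv; rewrite -star_mul; apply: h; first exact: subaM.
  exact: unitaryM.
- move=> a k ak Ka F P bF mP cP h.
  apply: (cP (fun p => avg (a p) F)); last by move=> p; exact: Ka.
  rewrite /avg; apply: cvg_big => [|i _]; first exact: add_continuous.
  apply: cvg_big => [|j _]; first exact: add_continuous.
  apply: (@cvg_rnorm_le _ _ _ _ _ _ _ (fun p => `|a p i j - k i j| * N (F (b i) (b j)))).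
    by near=> p; rewrite -scalerBl -rmorphB rnormZ.
  rewrite -(mul0r (N (F (b i) (b j)))); apply: cvgM; last exact: cvg_cst.
  rewrite -(@normr0 _ R) -(subrr (k i j)); apply: cvg_norm.
  by apply: cvgB; [exact: ak|exact: cvg_cst].
- move=> k Kk kG; exists k => // w F Dw uw bF.
  by rewrite -avg_act// kG//; exists w.
Unshelve. all: by end_near. Qed.

End basis.
End Mean.

Section MeanExists.
Variables (R : realType) (A : unitalCStarType R) (D : set A).
Implicit Types (x y z v w : A) (F G : A -> A -> A) (P : A -> Prop).
Implicit Types (M : (A -> A -> A) -> A).
Local Notation N := (@rnorm R A).
Local Open Scope complex_scope.

(** [M F] replaces the Haar integral of [F v (star v)]. Keeping the two arguments independent lets
    [mean_invariant] express the commutation of the underlying tensor with every [w] in [D], unitary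
    or not: it is a diagonal in the sense of amenability. *)
Record is_mean M : Prop := IsMean {
  mean_in : forall F P, rbilinear_on D F -> midconvex P -> seq_closed P ->
    (forall v, D v -> is_unitary v -> P (F v (star v))) -> P (M F);
  mean_invariant : forall F w, rbilinear_on D F -> D w ->
    M (fun x y => F (w * x) y) = M (fun x y => F x (y * w));
  meanD : forall F G, M (fun x y => F x y + G x y) = M F + M G;
  mean_comp : forall F (g : A -> A), {morph g : x y / x + y} ->
    (forall (r : R) x, g (r%:C *: x) = r%:C *: g x) ->
    M (fun x y => g (F x y)) = g (M F);
  mean_ext : forall F G, (forall x y, D x -> D y -> F x y = G x y) -> M F = M G
}.

(** A small self-adjoint element is the mean of two unitaries of [D], and ['i] times a unitary is
    unitary; so real combinations of unitaries reach both the real and the imaginary part of [x]. *)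
Lemma real_unitary_span (hD : is_unital_cstar_subalgebra D) P :
  (forall (r : R) x y, D x -> D y -> P x -> P y -> P (r%:C *: x + y)) ->
  (forall v, D v -> is_unitary v -> P v) -> forall x, D x -> P x.
Proof.
move=> Plin Pu.
have P0 : P 0.
  have D1 := suba1 hD.
  have := Plin (-1) 1 1 D1 D1 (Pu _ D1 (unitary1 A)) (Pu _ D1 (unitary1 A)).
  by rewrite rmorphN1 scaleN1r addNr.
have PZ (r : R) x : D x -> P x -> P (r%:C *: x).
  by move=> Dx Px; have := Plin r x 0 Dx (suba0 hD) Px P0; rewrite addr0.
have PD x y : D x -> D y -> P x -> P y -> P (x + y).
  by move=> Dx Dy Px Py; have := Plin 1 x y Dx Dy Px Py; rewrite rmorph1 scale1r.
have ui v : is_unitary v -> is_unitary ('i *: v).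
  have ci : ('i)^* = - 'i :> R[i] by apply/eqP; rewrite eq_complex /= oppr0 !eqxx.
  have ii : (- 'i : R[i]) * 'i = 1 by rewrite mulNr -expr2 sqr_i opprK.
  have ii' : ('i : R[i]) * - 'i = 1 by rewrite mulrN -expr2 sqr_i opprK.
  by case=> h1 h2; split; rewrite starZ ci -scalerAl -scalerAr scalerA (ii, ii') scale1r.
have sa h : D h -> star h = h -> P h /\ P ('i *: h).
  move=> Dh sh; pose r := 5 * (1 + N h).
  have r0 : 0 < r by rewrite mulr_gt0// ltr_wpDr// rnorm_ge0.
  have Drh : D ((r^-1)%:C *: h) by exact: subaZ.
  have srh : star ((r^-1)%:C *: h) = (r^-1)%:C *: h by rewrite starZr sh.
  have nrh : N ((r^-1)%:C *: h) <= 5^-1.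
    rewrite rnormZ gtr0_norm ?invr_gt0// ler_pdivrMl// /r.
    have := rnorm_ge0 h; lra.
  have [u [uu Du hu]] := unitary_dilation hD Drh srh nrh.
  have Dsu := suba_star hD Du; have su := unitary_star uu.
  have -> : h = (r / 2)%:C *: (u + star u).
    have -> : h = r%:C *: ((r^-1)%:C *: h).
      by rewrite scalerA -rmorphM divff ?gt_eqF// scale1r.
    by rewrite hu half_realE scalerA -rmorphM.
  split.
    by apply: PZ; [exact: subaD|apply: PD => //; exact: Pu].
  rewrite scalerA mulrC -scalerA scalerDr.
  have Diu := subaZ hD 'i Du; have Disu := subaZ hD 'i Dsu.
  by apply: PZ; [exact: subaD|apply: PD => //; apply: Pu => //; exact: ui].
move=> x Dx; have Dsx := suba_star hD Dx.
have -> : x = 2^-1 *: (x + star x) + 'i *: (2^-1 *: (- 'i *: (x - star x))).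
  have -> : 'i *: (2^-1 *: (- 'i *: (x - star x))) = (- 'i * 'i) *: (2^-1 *: (x - star x)).
    by rewrite !scalerA; congr (_ *: _); ring.
  by rewrite mulNr -expr2 sqr_i opprK; ncring.
have ci : (- 'i)^* = 'i :> R[i] by apply/eqP; rewrite eq_complex /= oppr0 opprK !eqxx.
have Ds := subaD hD Dx Dsx.
have Dd : D (- 'i *: (x - star x)) by apply: subaZ => //; exact: subaB.
apply: PD; [exact: subaZ|by apply: subaZ => //; exact: subaZ| |].
  rewrite half_realE; have [||//] := sa ((2^-1)%:C *: (x + star x)); first exact: subaZ.
  by rewrite starZr starD starK [star x + x]addrC.
rewrite half_realE; have [||_ h] := sa ((2^-1)%:C *: (- 'i *: (x - star x))).
- exact: subaZ.
- rewrite starZr starZ starB starK ci.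
  by rewrite -[in RHS](opprB (star x) x) scalerN scaleNr opprK.
exact: h.
Qed.

Lemma exists_mean : is_unital_cstar_subalgebra D -> finite_dimensional D ->
  exists M, is_mean M.
Proof.
move=> hD fD.
have [n [g gD]] := finite_dimensional_real_span fD.
have [m [b [bD bI]]] := real_span_basis gD.
have [k Kk kinv] := invariant_avg hD bD bI.
have Db i : D (b i) by exact: (@real_span_mem _ _ _ _ _ i bD).
exists (avg b k); split.
- by move=> F P *; apply: Kk.
- move=> F w bF Dw.
  (* Both sides are real-linear in [w], so that unitary [w] suffice. *)
  pose Q w := avg b k (fun x y => F (w * x) y) = avg b k (fun x y => F x (y * w)).
  move: w Dw; apply: (@real_unitary_span hD Q) => [r w w' Dw Dw' Qw Qw'|w Dw uw].
    rewrite /Q; case: bF => F1 F2.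
    transitivity (r%:C *: avg b k (fun x y => F (w * x) y) +
      avg b k (fun x y => F (w' * x) y)).
      rewrite /avg scaler_sumr -big_split; apply: eq_bigr => i _ /=.
      rewrite scaler_sumr -big_split; apply: eq_bigr => j _ /=.
      rewrite mulrDl -scalerAl F1 ?scalerDr ?scalerA 1?mulrC//; exact: subaM.
    rewrite Qw Qw' /avg scaler_sumr -big_split; apply: eq_bigr => i _ /=.
    rewrite scaler_sumr -big_split; apply: eq_bigr => j _ /=.
    by rewrite mulrDr -scalerAr F2 ?scalerDr ?scalerA 1?mulrC//; exact: subaM.
  (* Invariance, applied to this map, puts [y * star w * w = y] in the second argument. *)
  rewrite /Q -(kinv w (fun x y => F x (y * w))) //.
    apply: eq_bigr => i _; apply: eq_bigr => j _.
    by rewrite -(mulrA (b j)); case: uw => -> _; rewrite mulr1.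
  case: bF => F1 F2; split=> z Dz a x y Dx Dy.
    by apply: F1 => //; exact: subaM.
  by rewrite mulrDl -scalerAl; apply: F2 => //; exact: subaM.
- move=> F G; rewrite /avg -big_split; apply: eq_bigr => i _ /=.
  by rewrite -big_split; apply: eq_bigr => j _; rewrite scalerDr.
- move=> F h hadd hZ.
  have h0 : h 0 = 0 by apply: (addrI (h 0)); rewrite -hadd !addr0.
  rewrite /avg (big_morph h hadd h0); apply: eq_bigr => i _.
  by rewrite (big_morph h hadd h0); apply: eq_bigr => j _; rewrite hZ.
- by move=> F G FG; apply: eq_bigr => i _; apply: eq_bigr => j _; rewrite FG.
Qed.

End MeanExists.

(** * Smoothing along the flow *)

Section Flow.
Variables (R : realType) (A : unitalCStarType R) (alpha : R -> A -> A).
Hypothesis halpha : is_flow alpha.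
Implicit Types (x y z : A) (s t : R).
Local Notation N := (@rnorm R A).
Local Open Scope complex_scope.

Lemma flow_aut t : is_star_automorphism (alpha t).
Proof. by case: halpha. Qed.

Lemma flow_add s t x : alpha (s + t) x = alpha s (alpha t x).
Proof. by case: halpha => _ -> _. Qed.

Lemma flow0 x : alpha 0 x = x.
Proof.
have [_ _ _ /bij_inj inj] := flow_aut 0.
by apply: inj; rewrite -flow_add addr0.
Qed.

Lemma flowD t : {morph alpha t : x y / x + y}.
Proof. exact: autD (flow_aut t). Qed.

Lemma flowZ t (c : R[i]) x : alpha t (c *: x) = c *: alpha t x.
Proof. exact: autZ (flow_aut t) _ _. Qed.

Lemma flowB t x y : alpha t (x - y) = alpha t x - alpha t y.
Proof. exact: autB (flow_aut t) _ _. Qed.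

Lemma flowM t x y : alpha t (x * y) = alpha t x * alpha t y.
Proof. exact: autM (flow_aut t) _ _. Qed.

Lemma flow1 t : alpha t 1 = 1.
Proof. exact: aut1 (flow_aut t). Qed.

Lemma flow_star t x : alpha t (star x) = star (alpha t x).
Proof. exact: aut_star (flow_aut t) _. Qed.

Lemma flow_le t x : N (alpha t x) <= N x.
Proof. exact: aut_contractive (flow_aut t) _. Qed.

Lemma flow_norm t x : N (alpha t x) = N x.
Proof.
apply/le_anti; rewrite flow_le /= -{1}(flow0 x) -(addNr t) flow_add.
exact: flow_le.
Qed.

Lemma flow_unitary t v : is_unitary v -> is_unitary (alpha t v).
Proof. exact: aut_unitary (flow_aut t) _. Qed.

Lemma flow_cvg (T : Type) (F : set_system T) (FF : ProperFilter F) t (a : T -> A) l :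
  a @ F --> l -> (fun n => alpha t (a n)) @ F --> alpha t l.
Proof.
by apply: (@cvg_rlip _ _ _ _ _ _ _ _ 1) => [x y|x]; rewrite ?flowB// mul1r flow_le.
Qed.

Lemma flow_near x e : 0 < e ->
  exists2 r, 0 < r & forall t, `|t| < r -> N (alpha t x - x) < e.
Proof.
move=> e0; case: halpha => _ _ /(_ x 0).
rewrite /continuous_at flow0 => /cvg_rnormP/cvgrPdist_lt/(_ _ e0)[r /= r0 h].
exists r => // t tr; have := h t; rewrite /= !sub0r !normrN.
by rewrite (ger0_norm (rnorm_ge0 _)); apply.
Qed.

Definition dyadic (n : nat) : R := 2^-1 ^+ n.

Lemma dyadic_gt0 n : 0 < dyadic n.
Proof. by rewrite exprn_gt0// invr_gt0. Qed.

Lemma dyadicS n : dyadic n = dyadic n.+1 + dyadic n.+1.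
Proof. by rewrite /dyadic exprS; lra. Qed.

(** The average over [2^n] dyadic points factors into these operators for [j] from 1 to [n], which
    turns its properties into inductions on [n]. *)
Definition half_step j x : A := 2^-1 *: (x + alpha (dyadic j) x).

(* [dyadic_mean n x] is the average of [alpha (k / 2^n) x] over [0 <= k < 2^n];
   [dyadic_tail n k x] averages over the finer points of [0, 2^-n[. *)
Fixpoint dyadic_mean n x : A :=
  if n is n'.+1 then dyadic_mean n' (half_step n x) else x.

Fixpoint dyadic_tail n k x : A :=
  if k is k'.+1 then half_step n.+1 (dyadic_tail n.+1 k' x) else x.

Lemma half_stepB j x y : half_step j (x - y) = half_step j x - half_step j y.
Proof. by rewrite /half_step flowB; ncring. Qed.

Lemma half_stepD j x y : half_step j (x + y) = half_step j x + half_step j y.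
Proof. by rewrite /half_step flowD; ncring. Qed.

Lemma half_stepZ j (c : R[i]) x : half_step j (c *: x) = c *: half_step j x.
Proof. by rewrite /half_step flowZ; ncring. Qed.

Lemma half_step_le j x : N (half_step j x) <= N x.
Proof.
rewrite rnorm_half; have := rnormD x (alpha (dyadic j) x).
rewrite flow_norm; lra.
Qed.

Lemma half_step_flow j t x : half_step j (alpha t x) = alpha t (half_step j x).
Proof. by rewrite /half_step flowZ flowD -!flow_add (addrC t). Qed.

Lemma dyadic_meanB n x y : dyadic_mean n (x - y) = dyadic_mean n x - dyadic_mean n y.
Proof. by elim: n x y => //= n IH x y; rewrite half_stepB IH. Qed.

Lemma dyadic_meanD n x y : dyadic_mean n (x + y) = dyadic_mean n x + dyadic_mean n y.
Proof. by elim: n x y => //= n IH x y; rewrite half_stepD IH. Qed.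

Lemma dyadic_meanZ n (c : R[i]) x : dyadic_mean n (c *: x) = c *: dyadic_mean n x.
Proof. by elim: n x => //= n IH x; rewrite half_stepZ IH. Qed.

Lemma dyadic_mean_le n x : N (dyadic_mean n x) <= N x.
Proof. by elim: n x => //= n IH x; rewrite (le_trans (IH _))// half_step_le. Qed.

Lemma dyadic_mean_flow n t x : dyadic_mean n (alpha t x) = alpha t (dyadic_mean n x).
Proof. by elim: n x => //= n IH x; rewrite half_step_flow IH. Qed.

Lemma dyadic_mean_star n x : dyadic_mean n (star x) = star (dyadic_mean n x).
Proof.
elim: n x => //= n IH x; rewrite -IH /half_step; congr dyadic_mean.
rewrite half_realE.
by rewrite starZr starD flow_star.
Qed.

Lemma dyadic_mean1 n : dyadic_mean n 1 = 1.
Proof.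
elim: n => //= n IH; rewrite -[RHS]IH; congr dyadic_mean.
by rewrite /half_step flow1; ncring.
Qed.

Lemma dyadic_meanE n k x : dyadic_mean (n + k) x = dyadic_mean n (dyadic_tail n k x).
Proof.
elim: k n => [|k IH] n /=; first by rewrite addn0.
by rewrite addnS -addSn IH.
Qed.

Lemma dyadic_tailB n k x y : dyadic_tail n k (x - y) = dyadic_tail n k x - dyadic_tail n k y.
Proof. by elim: k n => //= k IH n; rewrite IH half_stepB. Qed.

Lemma dyadic_tail_flow n k t x : dyadic_tail n k (alpha t x) = alpha t (dyadic_tail n k x).
Proof. by elim: k n => //= k IH n; rewrite IH half_step_flow. Qed.

Lemma dyadic_tail_le n k x : N (dyadic_tail n k x) <= N x.
Proof. by elim: k n => //= k IH n; rewrite (le_trans (half_step_le _ _))// IH. Qed.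

(** The base point [s] must vary: a half step replaces the interval from [s] to [s + dyadic n] by
    its two halves. *)
Lemma dyadic_tail_near n k x e s : 0 <= s ->
  (forall r, s <= r <= s + dyadic n -> N (alpha r x - x) <= e) ->
  N (alpha s (dyadic_tail n k x) - x) <= e.
Proof.
elim: k n s => [|k IH] n s s0 h /=.
  by apply: h; rewrite lexx lerDl ltW// dyadic_gt0.
have d0 := dyadic_gt0 n.+1; have d2 := dyadicS n.
set y := dyadic_tail n.+1 k x.
have h1 : N (alpha s y - x) <= e.
  by apply: IH => // r /andP[r1 r2]; apply: h; lra.
have h2 : N (alpha (s + dyadic n.+1) y - x) <= e.
  by apply: IH => [|r /andP[r1 r2]]; [lra|apply: h; lra].
have -> : alpha s (half_step n.+1 y) - x =
    2^-1 *: ((alpha s y - x) + (alpha (s + dyadic n.+1) y - x)).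
  by rewrite /half_step flowZ flowD flow_add; ncring.
rewrite rnorm_half; have := rnormD (alpha s y - x) (alpha (s + dyadic n.+1) y - x).
lra.
Qed.

(** The sum over a grid of step [dyadic n] telescopes under the shift by one step; inductively,
    [(alpha_h - 1)(1 + alpha_h) = alpha_(2h) - 1]. *)
Lemma dyadic_mean_telescope n x :
  alpha (dyadic n) (dyadic_mean n x) - dyadic_mean n x =
    (dyadic n)%:C *: (alpha 1 x - x).
Proof.
elim: n x => [|n IH] x /=; first by rewrite /dyadic expr0 scale1r.
have -> : alpha (dyadic n.+1) (dyadic_mean n (half_step n.+1 x)) -
    dyadic_mean n (half_step n.+1 x) =
    2^-1 *: (alpha (dyadic n) (dyadic_mean n x) - dyadic_mean n x).
  rewrite -!dyadic_mean_flow -!dyadic_meanB -dyadic_meanZ; congr dyadic_mean.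
  by rewrite {1}/half_step flowZ flowD -flow_add -dyadicS /half_step; ncring.
rewrite IH scalerA; congr (_ *: _).
by rewrite {2}/dyadic exprS rmorphM fmorphV rmorph_nat.
Qed.

(** A finer mean is the coarse mean of a tail average, and this average runs over times so short
    that it is close to [x]. *)
Lemma dyadic_mean_cvg x : cvg ((fun n => dyadic_mean n x) @ \oo).
Proof.
apply: cauchy_rnorm_ex => e e0.
have [r r0 hr] := flow_near x e0.
have /cvgrPdist_lt/(_ _ r0)[n _ hn] := cvg_half_pow (1 : R).
exists n => m /subnKC <-; rewrite dyadic_meanE -dyadic_meanB.
apply: le_trans (dyadic_mean_le _ _) _.
rewrite -[dyadic_tail _ _ _]flow0; apply: dyadic_tail_near => // s /andP[s0].
rewrite add0r => sn; apply/ltW/hr; rewrite ger0_norm//; apply: le_lt_trans sn _.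
have := hn n (leqnn n); rewrite /= sub0r normrN mul1r; exact: le_lt_trans (ler_norm _).
Qed.

Definition flow_mean x : A := lim ((fun n => dyadic_mean n x) @ \oo).

Lemma flow_mean_lin (c : R[i]) x y :
  flow_mean (c *: x + y) = c *: flow_mean x + flow_mean y.
Proof.
have h1 := @dyadic_mean_cvg x; have h2 := @dyadic_mean_cvg y.
apply: (cvg_eq (@dyadic_mean_cvg (c *: x + y)) (cvgD (cvgZr h1) h2)) => n /=.
by rewrite dyadic_meanD dyadic_meanZ.
Qed.

Lemma flow_mean_star x : flow_mean (star x) = star (flow_mean x).
Proof.
apply: (cvg_eq (@dyadic_mean_cvg (star x)) (cvg_star (@dyadic_mean_cvg x))) => n.
by rewrite dyadic_mean_star.
Qed.

Lemma flow_mean1 : flow_mean 1 = 1.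
Proof.
apply: (cvg_eq (@dyadic_mean_cvg 1) (cvg_cst (1 : A))) => n.
by rewrite dyadic_mean1.
Qed.

Lemma flow_mean_near x e : (forall s, 0 <= s <= 1 -> N (alpha s x - x) <= e) ->
  N (flow_mean x - x) <= e.
Proof.
move=> h; apply: (@cvg_rnorm_bound _ _ _ \oo _ (fun n => dyadic_mean n x - x)).
  by apply: cvgB; [exact: dyadic_mean_cvg|exact: cvg_cst].
near=> n; rewrite -(add0n n) dyadic_meanE /= -[dyadic_tail _ _ _]flow0.
by apply: dyadic_tail_near => // r; rewrite /dyadic expr0 add0r; exact: h.
Unshelve. all: by end_near. Qed.

(** Displacing the integral over [0, 1] by [h] changes it only near the two ends, over length [h].
    On the grids this is exact for dyadic [h], by telescoping of the coarse part. *)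
Lemma flow_mean_lip n x :
  N (alpha (dyadic n) (flow_mean x) - flow_mean x) <= dyadic n * N (alpha 1 x - x).
Proof.
apply: (@cvg_rnorm_bound _ _ _ \oo _
    (fun m => alpha (dyadic n) (dyadic_mean m x) - dyadic_mean m x)).
  by apply: cvgB; [apply: flow_cvg|]; exact: dyadic_mean_cvg.
near=> m.
have /subnKC <- : (n <= m)%N by near: m; exact: nbhs_infty_ge.
rewrite dyadic_meanE dyadic_mean_telescope rnormZ gtr0_norm ?dyadic_gt0//.
by rewrite ler_pM2l ?dyadic_gt0// -dyadic_tail_flow -dyadic_tailB dyadic_tail_le.
Unshelve. all: by end_near. Qed.

Lemma flow_mean_le x : N (flow_mean x) <= N x.
Proof.
apply: (@cvg_rnorm_bound _ _ _ \oo _ (fun n => dyadic_mean n x)).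
  exact: dyadic_mean_cvg.
by near=> n; exact: dyadic_mean_le.
Unshelve. all: by end_near. Qed.

End Flow.

(** * From almost homomorphisms to homomorphisms *)

Section MeanTheory.
Variables (R : realType) (A : unitalCStarType R) (D : set A).
Variables (M : (A -> A -> A) -> A).
Hypothesis hM : is_mean D M.
Implicit Types (x y z v w : A) (F G : A -> A -> A).
Local Notation N := (@rnorm R A).
Local Open Scope complex_scope.

(** What the estimates use of a norm, so that they apply both to [rnorm] and to the norms measuring
    displacement. Closedness of the balls carries bounds to means and limits. *)
Record algebra_norm (nu : A -> R) : Prop := AlgebraNorm {
  algnormD : forall x y, nu (x + y) <= nu x + nu y;
  algnormZ : forall (r : R) x, nu (r%:C *: x) = `|r| * nu x;
  algnormM : forall x y, nu (x * y) <= nu x * nu y;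
  algnorm_closed : forall c, seq_closed (fun x => nu x <= c)
}.

Lemma algnorm_half nu x : algebra_norm nu -> nu (2^-1 *: x) = 2^-1 * nu x.
Proof.
rewrite half_realE.
by move=> h; rewrite algnormZ// ger0_norm ?invr_ge0.
Qed.

Lemma algnormN nu x : algebra_norm nu -> nu (- x) = nu x.
Proof.
move=> h; rewrite -scaleN1r -(rmorphN1 (real_complex R)) algnormZ//.
by rewrite normrN1 mul1r.
Qed.

Lemma algnorm0 nu : algebra_norm nu -> nu 0 = 0.
Proof. by move=> h; rewrite -(scale0r 0) -(rmorph0 (real_complex R)) algnormZ// normr0 mul0r. Qed.

Lemma algnorm_ge0 nu x : algebra_norm nu -> 0 <= nu x.
Proof.
move=> h; have := algnormD h x (- x); rewrite subrr algnorm0// algnormN//; lra.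
Qed.

Lemma algnormM_le nu x y a b : algebra_norm nu -> nu x <= a -> nu y <= b ->
  nu (x * y) <= a * b.
Proof.
by move=> h xa yb; rewrite (le_trans (algnormM h _ _))// ler_pM ?algnorm_ge0.
Qed.

Lemma algebra_norm_rnorm : algebra_norm N.
Proof.
split; [exact: rnormD|exact: rnormZ|exact: rnormM|].
by move=> c a l al ac; apply: (cvg_rnorm_bound al); near=> n; exact: ac.
Unshelve. all: by end_near. Qed.

Lemma meanN F : M (fun x y => - F x y) = - M F.
Proof.
by apply: (mean_comp hM F (g := fun x => - x)) => [x y|r x]; rewrite ?opprD ?scalerN.
Qed.

Lemma meanB F G : M (fun x y => F x y - G x y) = M F - M G.
Proof. by rewrite (meanD hM F) meanN. Qed.

Lemma mean_mull F z : M (fun x y => z * F x y) = z * M F.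
Proof.
by apply: (mean_comp hM F (g := fun x => z * x)) => [x y|r x]; rewrite ?mulrDr ?scalerAr.
Qed.

Lemma mean_mulr F z : M (fun x y => F x y * z) = M F * z.
Proof.
by apply: (mean_comp hM F (g := fun x => x * z)) => [x y|r x]; rewrite ?mulrDl ?scalerAl.
Qed.

Lemma meanZ F (r : R[i]) : M (fun x y => r *: F x y) = r *: M F.
Proof.
apply: (mean_comp hM F (g := fun x => r *: x)) => [x y|s x]; rewrite ?scalerDr//.
by rewrite !scalerA mulrC.
Qed.

Lemma mean_star F : M (fun x y => star (F x y)) = star (M F).
Proof.
apply: (mean_comp hM F (g := @star R A)) => [x y|s x]; first by rewrite starD.
exact: starZr.
Qed.

Lemma mean_cst F c : rbilinear_on D F ->
  (forall v, D v -> is_unitary v -> F v (star v) = c) -> M F = c.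
Proof.
move=> bF h; apply: (mean_in hM bF (P := fun x => x = c)) => //.
  move=> x y -> ->; have -> : c + c = 2 *: c by ncring.
  by rewrite scalerA mulVf ?scale1r// pnatr_eq0.
by move=> a l al ac; apply: (cvg_eq al (cvg_cst c)).
Qed.

Lemma rbilinearB F G : rbilinear_on D F -> rbilinear_on D G ->
  rbilinear_on D (fun x y => F x y - G x y).
Proof.
move=> [F1 F2] [G1 G2]; split=> z Dz a x y Dx Dy.
  by rewrite F1// G1//; ncring.
by rewrite F2// G2//; ncring.
Qed.

(** Only values at the pairs [v, star v] matter. This identifies the adjoint of a mean, where [v]
    and [u] are replaced by [star u] and [star v]. *)
Lemma mean_eq F G : rbilinear_on D F -> rbilinear_on D G ->
  (forall v, D v -> is_unitary v -> F v (star v) = G v (star v)) -> M F = M G.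
Proof.
move=> bF bG h; apply/eqP; rewrite -subr_eq0 -meanB; apply/eqP.
apply: mean_cst; first exact: rbilinearB.
by move=> v Dv uv; rewrite h// subrr.
Qed.

Lemma mean_le nu F c : algebra_norm nu -> rbilinear_on D F ->
  (forall v, D v -> is_unitary v -> nu (F v (star v)) <= c) -> nu (M F) <= c.
Proof.
move=> hnu bF; apply: (mean_in hM bF (P := fun x => nu x <= c)).
  move=> x y xc yc; rewrite algnorm_half//; have := algnormD hnu x y; lra.
exact: algnorm_closed.
Qed.

End MeanTheory.

(** * Johnson's correction and its quadratic error *)

Section Johnson.
Variables (R : realType) (A : unitalCStarType R) (D : set A).
Hypothesis hD : is_unital_cstar_subalgebra D.
Variables (M : (A -> A -> A) -> A).
Hypothesis hM : is_mean D M.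
Implicit Types (x y z v w : A) (F G : A -> A -> A) (phi : A -> A).
Local Notation N := (@rnorm R A).
Local Open Scope complex_scope.

Record unital_star_linear phi : Prop := UnitalStarLinear {
  usl_lin : forall (r : R) x y, phi (r%:C *: x + y) = r%:C *: phi x + phi y;
  usl_star : forall x, phi (star x) = star (phi x);
  usl_one : phi 1 = 1
}.

Definition defect phi x y : A := phi (x * y) - phi x * phi y.

(** The mean of either summand would cancel the defect to first order. Adjoints exchange the two
    summands, and half their sum keeps [improve phi] compatible with [star]. *)
Definition correction phi x : A := 2^-1 *:
  M (fun v w => phi v * defect phi w x + defect phi x v * phi w).

Definition improve phi x : A := phi x + correction phi x.

Section step.
Variable phi : A -> A.
Hypothesis hphi : unital_star_linear phi.
Local Notation T := (defect phi).

Lemma defect_linl (r : R) x y z : T (r%:C *: x + y) z = r%:C *: T x z + T y z.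
Proof.
rewrite /defect mulrDl cscalerl !(usl_lin hphi).
by ncring.
Qed.

Lemma defect_linr (r : R) x y z : T z (r%:C *: x + y) = r%:C *: T z x + T z y.
Proof.
rewrite /defect mulrDr cscalerr !(usl_lin hphi).
by ncring.
Qed.

Lemma defect_star x y : star (T x y) = T (star y) (star x).
Proof. by rewrite /defect starB !star_mul -!(usl_star hphi) star_mul. Qed.

(** Hochschild's 2-cocycle identity; it comes from associativity and is exact although [phi] is not
    multiplicative. *)
Lemma defect_cocycle x y z :
  T x (y * z) = T (x * y) z + T x y * phi z - phi x * T y z.
Proof. by rewrite /defect !mulrA; ncring. Qed.

Lemma defect_one x : T x 1 = 0 /\ T 1 x = 0.
Proof. by rewrite /defect (usl_one hphi) !mulr1 !mul1r !subrr. Qed.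

Ltac bilin := split=> ? _ ? ? ? _ _;
  rewrite ?(usl_lin hphi, defect_linl, defect_linr); by ncring.

Lemma improve_usl : unital_star_linear (improve phi).
Proof.
split.
- move=> r x y; rewrite /improve /correction (usl_lin hphi).
  rewrite (mean_ext hM (G := fun v w =>
    r%:C *: (phi v * T w x + T x v * phi w) + (phi v * T w y + T y v * phi w))).
    by rewrite (meanD hM (fun v w => r%:C *: (phi v * T w x + T x v * phi w))) (meanZ hM);
      ncring.
  by move=> v w _ _; rewrite defect_linl defect_linr; ncring.
- move=> x; rewrite /improve starD (usl_star hphi); congr (_ + _).
    rewrite /correction half_realE starZr -(mean_star hM); congr (_ *: _).
  rewrite (mean_ext hM (F := fun v w => star _) (G := fun v w =>
      T (star x) (star w) * phi (star v) + phi (star w) * T (star v) (star x))); last first.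
    by move=> v w _ _; rewrite starD !star_mul !defect_star !(usl_star hphi).
  apply: (mean_eq hM); first by bilin.
    split=> ? _ ? ? ? _ _; rewrite starD starZr;
    rewrite ?(usl_lin hphi, defect_linl, defect_linr); by ncring.
  by move=> v _ _; rewrite starK addrC.
- rewrite /improve /correction (usl_one hphi) (mean_cst hM (c := 0)) ?scaler0 ?addr0//.
    by bilin.
  by move=> v _ _; have [-> _] := defect_one (star v); have [_ ->] := defect_one v;
    rewrite mulr0 mul0r addr0.
Qed.

(* The first order terms cancel, by the cocycle identity for the defect and the
   invariance of the mean. *)
Lemma improve_defect x y : D x -> D y -> defect (improve phi) x y =
  M (fun v w => T x v * T w y) + 2^-1 *: (M T * T x y + T x y * M T)
  - correction phi x * correction phi y.
Proof.
move=> Dx Dy.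
pose psi1 x := M (fun v w => phi v * T w x).
pose psi2 x := M (fun v w => T x v * phi w).
have psiE z : correction phi z = 2^-1 *: (psi1 z + psi2 z).
  by rewrite /correction (meanD hM (fun v w => phi v * T w z)).
have MT : M (fun v w => phi v * phi w) = 1 - M T.
  rewrite (mean_ext hM (G := fun v w => phi (v * w) - T v w)); last first.
    by move=> v w _ _; rewrite /defect opprB addrC subrK.
  rewrite (meanB hM (fun v w => phi (v * w))); congr (_ - _).
  apply: (mean_cst hM).
    split=> ? _ ? ? ? _ _; rewrite ?(mulrDl, mulrDr) ?(cscalerl, cscalerr).
      by rewrite (usl_lin hphi).
    by rewrite (usl_lin hphi).
  by move=> v _ [_ ->]; exact: usl_one.
have E1 : psi1 (x * y) = psi1 x * phi y + phi x * psi1 y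
    + M (fun v w => T x v * T w y) - (1 - M T) * T x y.
  rewrite /psi1 (mean_ext hM (G := fun v w =>
      phi v * T (w * x) y + (phi v * T w x) * phi y - (phi v * phi w) * T x y)); last first.
    by move=> v w _ _; rewrite (defect_cocycle w); ncring.
  rewrite (meanB hM (fun v w => phi v * T (w * x) y + (phi v * T w x) * phi y)).
  rewrite (meanD hM (fun v w => phi v * T (w * x) y)) !(mean_mulr hM) MT; congr (_ - _).
  (* Invariance moves [x] to the left factor, and [phi (x * v) = phi x * phi v + T x v] yields
     [phi x * psi1 y] plus a second order term. *)
  rewrite -(mean_invariant hM (F := fun v w => phi v * T w y) (w := x))//; last by bilin.
  rewrite (mean_ext hM (G := fun v w => phi x * (phi v * T w y) + T x v * T w y)).
    by rewrite (meanD hM (fun v w => phi x * (phi v * T w y))) (mean_mull hM); ncring.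
  by move=> v w _ _; rewrite /defect; ncring.
have E2 : psi2 (x * y) = psi2 x * phi y + phi x * psi2 y
    + M (fun v w => T x v * T w y) - T x y * (1 - M T).
  rewrite /psi2 (mean_ext hM (G := fun v w =>
      phi x * (T y v * phi w) + T x (y * v) * phi w - T x y * (phi v * phi w))); last first.
    by move=> v w _ _; rewrite (defect_cocycle x y v); ncring.
  rewrite (meanB hM (fun v w => phi x * (T y v * phi w) + T x (y * v) * phi w)).
  rewrite (meanD hM (fun v w => phi x * (T y v * phi w))) !(mean_mull hM) MT; congr (_ - _).
  rewrite (mean_invariant hM (F := fun v w => T x v * phi w) (w := y))//; last by bilin.
  rewrite (mean_ext hM (F := fun v w => T x v * phi (w * y))
    (G := fun v w => (T x v * phi w) * phi y + T x v * T w y)).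
    by rewrite (meanD hM (fun v w => (T x v * phi w) * phi y)) (mean_mulr hM); ncring.
  by move=> v w _ _; rewrite /defect; ncring.
have -> : defect (improve phi) x y = T x y + correction phi (x * y)
    - correction phi x * phi y - phi x * correction phi y
    - correction phi x * correction phi y.
  by rewrite /defect /improve; ncring.
congr (_ - _); rewrite !psiE E1 E2.
move: (psi1 x) (psi1 y) (psi2 x) (psi2 y) (M T) (M _) => a b c d e f.
by ncring.
Qed.

Variables (nu : A -> R) (K tau : R).
Hypothesis hnu : algebra_norm nu.
Hypothesis hK : forall x, D x -> nu (phi x) <= K * N x.
Hypothesis htau : forall x y, D x -> D y -> nu (T x y) <= tau * N x * N y.

Lemma correction_le x : D x -> nu (correction phi x) <= K * tau * N x.
Proof.
move=> Dx; rewrite algnorm_half// ler_pdivrMl//.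
apply: (mean_le hM) => //; first by bilin.
move=> v Dv uv; have Nv := unitary_norm uv.
have Dv' := suba_star hD Dv; have Nv' : N (star v) = 1 by rewrite rnorm_star.
apply: le_trans (algnormD hnu _ _) _.
have h1 := algnormM_le hnu (hK Dv) (htau Dv' Dx).
have h2 := algnormM_le hnu (htau Dx Dv) (hK Dv').
rewrite Nv Nv' in h1 h2; lra.
Qed.

Lemma improve_defect_le x y : D x -> D y ->
  nu (defect (improve phi) x y) <= (2 + K ^+ 2) * tau ^+ 2 * N x * N y.
Proof.
move=> Dx Dy; rewrite improve_defect//.
have hMT : nu (M T) <= tau.
  apply: (mean_le hM) => //; first by bilin.
  move=> v Dv uv; have := htau Dv (suba_star hD Dv).
  by rewrite rnorm_star (unitary_norm uv) !mulr1.
have h1 : nu (M (fun v w => T x v * T w y)) <= (tau * N x) * (tau * N y).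
  apply: (mean_le hM) => //; first by bilin.
  move=> v Dv uv; have Nv := unitary_norm uv.
  have := algnormM_le hnu (htau Dx Dv) (htau (suba_star hD Dv) Dy).
  by rewrite rnorm_star Nv !mulr1.
have h2 := algnormM_le hnu hMT (htau Dx Dy).
have h3 := algnormM_le hnu (htau Dx Dy) hMT.
have h4 := algnormM_le hnu (correction_le Dx) (correction_le Dy).
apply: le_trans (algnormD hnu _ _) _; rewrite algnormN//.
have h5 := algnormD hnu (M (fun v w => T x v * T w y))
  (2^-1 *: (M T * T x y + T x y * M T)).
rewrite algnorm_half// in h5.
have h6 := algnormD hnu (M T * T x y) (T x y * M T).
have -> : (2 + K ^+ 2) * tau ^+ 2 * N x * N y =
  (tau * N x) * (tau * N y) + 2^-1 * (tau * (tau * N x * N y) + tau * N x * N y * tau)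
  + (K * tau * N x) * (K * tau * N y) by field.
lra.
Qed.

End step.
End Johnson.

(** * Convergence of the iteration *)

Section JohnsonLimit.
Variables (R : realType) (A : unitalCStarType R) (D : set A).
Hypothesis hD : is_unital_cstar_subalgebra D.
Variables (M : (A -> A -> A) -> A).
Hypothesis hM : is_mean D M.
Implicit Types (x y z v w : A) (rho : A -> A).
Local Notation N := (@rnorm R A).
Local Open Scope complex_scope.

Record unital_star_hom_on rho : Prop := UnitalStarHomOn {
  ush_lin : rlinear_on D rho;
  ush_mul : forall x y, D x -> D y -> rho (x * y) = rho x * rho y;
  ush_star : forall x, D x -> rho (star x) = star (rho x);
  ush_one : rho 1 = 1
}.

Section iterate.
Variable phi : A -> A.
Hypothesis hphi : unital_star_linear phi.
Variables (K tau : R).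
Hypothesis K0 : 0 <= K.
Hypothesis tau0 : 0 <= tau.
Hypothesis Ktau : K + 4 * tau <= 2.
Hypothesis tau12 : 12 * tau <= 1.

Definition johnson n := iter n (improve M) phi.

Lemma johnson_usl n : unital_star_linear (johnson n).
Proof. by elim: n => //= n IH; exact: (improve_usl hM IH). Qed.

(** The four bounds support each other: the increments [2 * tau * 2^-1 ^+ n] sum to at most
    [4 * tau], so the iterates stay bounded by [K + 4 * tau <= 2]; then [2 + K ^+ 2] becomes at most
    6, and [12 * tau <= 1] makes each step at least halve the defect. *)
Lemma johnson_bound nu : algebra_norm nu ->
  (forall x, D x -> nu (phi x) <= K * N x) ->
  (forall x y, D x -> D y -> nu (defect phi x y) <= tau * N x * N y) ->
  forall n, [/\
    forall x, D x -> nu (johnson n x) <= (K + 4 * tau * (1 - 2^-1 ^+ n)) * N x,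
    forall x y, D x -> D y ->
      nu (defect (johnson n) x y) <= tau * 2^-1 ^+ n * N x * N y,
    forall x, D x -> nu (johnson n.+1 x - johnson n x) <= 2 * tau * 2^-1 ^+ n * N x
    & forall x, D x -> nu (johnson n x - phi x) <= 4 * tau * (1 - 2^-1 ^+ n) * N x].
Proof.
move=> hnu hK htau n.
have step k : [/\ 0 <= 2^-1 ^+ k :> R, 2^-1 ^+ k <= 1 :> R,
    2^-1 ^+ k.+1 = 2^-1 * 2^-1 ^+ k :> R, 0 <= tau * 2^-1 ^+ k
    & tau * 2^-1 ^+ k <= tau].
  have h0 : 0 <= 2^-1 ^+ k :> R by apply: exprn_ge0; lra.
  have h1 : 2^-1 ^+ k <= 1 :> R by apply: exprn_ile1; lra.
  by split => //; [exact: exprS|exact: mulr_ge0|rewrite ler_piMr].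
have Kbnd p : 0 <= tau * p -> tau * p <= tau ->
    K + 4 * tau * (1 - p) <= 2 /\ 0 <= K + 4 * tau * (1 - p).
  move=> h0 h1; have := Ktau; have := K0; rewrite mulrBr mulr1 -mulrA; split; lra.
have incr k x : (forall x, D x ->
      nu (johnson k x) <= (K + 4 * tau * (1 - 2^-1 ^+ k)) * N x) ->
    (forall x y, D x -> D y ->
      nu (defect (johnson k) x y) <= tau * 2^-1 ^+ k * N x * N y) ->
    D x -> nu (johnson k.+1 x - johnson k x) <= 2 * tau * 2^-1 ^+ k * N x.
  move=> hk1 hk2 Dx; have [p0 p1 _ tp0 tp1] := step k.
  have -> : johnson k.+1 x - johnson k x = correction M (johnson k) x.
    by rewrite /= /improve addrC addKr.
  have [K2 Kp] := Kbnd _ tp0 tp1.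
  apply: le_trans (correction_le hD hM (johnson_usl k) hnu hk1 hk2 Dx) _.
  rewrite ler_wpM2r ?rnorm_ge0// mulrA ler_wpM2r// ler_wpM2r//.
elim: n => [|n [IH1 IH2 IH3 IH4]].
  have h1 x : D x -> nu (johnson 0 x) <= (K + 4 * tau * (1 - 2^-1 ^+ 0)) * N x.
    by move=> Dx; rewrite expr0 subrr mulr0 addr0; exact: hK.
  have h2 x y : D x -> D y ->
      nu (defect (johnson 0) x y) <= tau * 2^-1 ^+ 0 * N x * N y.
    by move=> Dx Dy; rewrite expr0 mulr1; exact: htau.
  split => // x Dx; first exact: incr.
  by rewrite subrr algnorm0// expr0 subrr mulr0 mul0r.
have [p0 p1 pS tp0 tp1] := step n.
have h1 x : D x ->
    nu (johnson n.+1 x) <= (K + 4 * tau * (1 - 2^-1 ^+ n.+1)) * N x.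
  move=> Dx; have := algnormD hnu (johnson n.+1 x - johnson n x) (johnson n x).
  rewrite subrK => h; have := IH1 x Dx; have := IH3 x Dx; rewrite pS; lra.
have h2 x y : D x -> D y ->
    nu (defect (johnson n.+1) x y) <= tau * 2^-1 ^+ n.+1 * N x * N y.
  move=> Dx Dy.
  have [K2 Kp] := Kbnd _ tp0 tp1.
  apply: le_trans (improve_defect_le hD hM (johnson_usl n) hnu IH1 IH2 Dx Dy) _.
  rewrite ler_wpM2r ?rnorm_ge0// ler_wpM2r ?rnorm_ge0// pS.
  have h6 k : 0 <= k -> k <= 2 -> 2 + k ^+ 2 <= 6 :> R by move=> *; nra.
  have h7 : tau * 2^-1 ^+ n <= 12^-1 by have := tau12; lra.
  have -> : tau * (2^-1 * 2^-1 ^+ n) = 6 * 12^-1 * (tau * 2^-1 ^+ n) by field.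
  rewrite [(tau * _) ^+ 2]expr2 mulrA ler_wpM2r//.
  by apply: ler_pM => //; [have := sqr_ge0 (K + 4 * tau * (1 - 2^-1 ^+ n)); lra|exact: h6].
split => // x Dx; first exact: incr.
have := algnormD hnu (johnson n.+1 x - johnson n x) (johnson n x - phi x).
rewrite addrA subrK => h; have := IH4 x Dx; have := IH3 x Dx; rewrite pS; lra.
Qed.

Hypothesis hK : forall x, D x -> N (phi x) <= K * N x.
Hypothesis htau : forall x y, D x -> D y -> N (defect phi x y) <= tau * N x * N y.

Lemma johnson_cvg x : D x -> cvg ((fun n => johnson n x) @ \oo).
Proof.
move=> Dx; have b := johnson_bound (algebra_norm_rnorm A) hK htau.
have [n|l [hl _]] := @geometric_cvg R A (fun n => johnson n x) (2 * tau * N x).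
  by have [_ _ h _] := b n; rewrite mulrAC; exact: h.
by apply/cvg_ex; exists l.
Qed.

(* The iterates do not involve the norm, so that their limit is close to [phi]
   in all the norms [nu] at once. *)
Lemma almost_hom_near_hom : exists rho, unital_star_hom_on rho /\
  forall nu, algebra_norm nu ->
    (forall x, D x -> nu (phi x) <= K * N x) ->
    (forall x y, D x -> D y -> nu (defect phi x y) <= tau * N x * N y) ->
    forall x, D x -> nu (rho x - phi x) <= 4 * tau * N x.
Proof.
pose rho x := lim ((fun n => johnson n x) @ \oo).
have rhoP x : D x -> (fun n => johnson n x) @ \oo --> rho x by exact: johnson_cvg.
have b := johnson_bound (algebra_norm_rnorm A) hK htau.
exists rho; split.
  split.
  - move=> a x y Dx Dy.
    have Dxy : D (a%:C *: x + y) by apply: subaD => //; exact: subaZ.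
    apply: (cvg_eq (rhoP _ Dxy) (cvgD (cvgZr (rhoP _ Dx)) (rhoP _ Dy))) => n.
    exact: usl_lin (johnson_usl n) _ _ _.
  - move=> x y Dx Dy; have Dxy : D (x * y) by exact: subaM.
    have h : (fun n => defect (johnson n) x y) @ \oo --> rho (x * y) - rho x * rho y.
      by apply: cvgB; [exact: rhoP|apply: cvg_cstarM; exact: rhoP].
    have h0 : (fun n => defect (johnson n) x y) @ \oo --> (0 : A).
      apply: (cvg_rnorm_le _ (cvg_half_pow (tau * N x * N y))).
      near=> n; have [_ h2 _ _] := b n; rewrite subr0.
      apply: le_trans (h2 x y Dx Dy) _; rewrite le_eqVlt; apply/orP; left; apply/eqP.
      by ring.
    by apply/eqP; rewrite -subr_eq0; apply/eqP; exact: (cvg_eq h h0).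
  - move=> x Dx; have Dsx := suba_star hD Dx.
    apply: (cvg_eq (rhoP _ Dsx) (cvg_star (rhoP _ Dx))) => n.
    exact: usl_star (johnson_usl n) _.
  - apply: (cvg_eq (rhoP _ (suba1 hD)) (cvg_cst (1 : A))) => n.
    exact: usl_one (johnson_usl n).
move=> nu hnu nK ntau x Dx.
apply: (algnorm_closed hnu (a := fun n => johnson n x - phi x)).
  by apply: cvgB; [exact: rhoP|exact: cvg_cst].
move=> n; have [_ _ _ h] := johnson_bound hnu nK ntau n.
apply: le_trans (h x Dx) _; rewrite ler_wpM2r ?rnorm_ge0// ler_piMr ?mulr_ge0//.
Unshelve. all: by end_near. Qed.

End iterate.
End JohnsonLimit.

(** * Regularization of the subalgebra *)

Section Regularize.
Variables (R : realType) (A : unitalCStarType R) (alpha : R -> A -> A).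
Hypothesis halpha : is_flow alpha.
Variable D : set A.
Hypothesis hD : is_unital_cstar_subalgebra D.
Variables (M : (A -> A -> A) -> A).
Hypothesis hM : is_mean D M.
Implicit Types (x y z v w : A).
Local Notation N := (@rnorm R A).
Local Open Scope complex_scope.

Definition lipnorm (h : R) x : R := N x + h^-1 * N (alpha h x - x).

Lemma rnorm_le_lipnorm h x : 0 < h -> N x <= lipnorm h x.
Proof. by move=> h0; rewrite lerDl mulr_ge0 ?rnorm_ge0// invr_ge0 ltW. Qed.

(** [alpha h - id] is a derivation twisted by [alpha h], and [alpha h] is isometric; in the product
    of two values of [lipnorm h], the product of the two difference quotients is slack. *)
Lemma lipnorm_algebra_norm h : 0 < h -> algebra_norm (lipnorm h).
Proof.
move=> h0; have hV : 0 < h^-1 by rewrite invr_gt0.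
split.
- move=> x y; rewrite /lipnorm addrACA -mulrDr lerD ?rnormD// ler_pM2l//.
  by rewrite flowD// opprD addrACA rnormD.
- move=> r x; rewrite /lipnorm flowZ// -scalerBr !rnormZ; ring.
- move=> x y; rewrite /lipnorm flowM//.
  have -> : alpha h x * alpha h y - x * y =
    alpha h x * (alpha h y - y) + (alpha h x - x) * y by ncring.
  have h1 := rnormM x y.
  have h2 := rnormM (alpha h x) (alpha h y - y); rewrite flow_norm// in h2.
  have h3 := rnormM (alpha h x - x) y.
  have h4 := rnormD (alpha h x * (alpha h y - y)) ((alpha h x - x) * y).
  have h5 : h^-1 * N (alpha h x * (alpha h y - y) + (alpha h x - x) * y) <=
    h^-1 * (N x * N (alpha h y - y) + N (alpha h x - x) * N y).
    by rewrite ler_pM2l//; lra.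
  have h6 : 0 <= (h^-1 * N (alpha h x - x)) * (h^-1 * N (alpha h y - y)).
    by rewrite !mulr_ge0 ?rnorm_ge0// ltW.
  have -> : (N x + h^-1 * N (alpha h x - x)) * (N y + h^-1 * N (alpha h y - y)) =
    N x * N y + h^-1 * (N x * N (alpha h y - y) + N (alpha h x - x) * N y)
    + (h^-1 * N (alpha h x - x)) * (h^-1 * N (alpha h y - y)) by ring.
  lra.
- move=> c a l al ac.
  suff /cvgr_to_le : (fun n => lipnorm h (a n)) @ \oo --> lipnorm h l.
    by apply; near=> n; exact: ac.
  apply: cvgD; first exact: cvg_rnorm.
  apply: cvgM; first exact: cvg_cst.
  by apply: cvg_rnorm; apply: cvgB => //; exact: flow_cvg.
Unshelve. all: by end_near. Qed.

Variable delta : R.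
Hypothesis delta0 : 0 <= delta.
Hypothesis delta72 : 72 * delta <= 1.
Hypothesis hdelta : forall t x, `|t| <= 1 -> D x -> N (alpha t x - x) <= delta * N x.

Local Notation phi := (flow_mean alpha).

Lemma flow_mean_usl : unital_star_linear phi.
Proof.
split; [by move=> r x y; exact: flow_mean_lin|exact: flow_mean_star|exact: flow_mean1].
Qed.

Lemma flow_mean_dist x : D x -> N (phi x - x) <= delta * N x.
Proof.
move=> Dx; apply: flow_mean_near => // s /andP[s0 s1].
by apply: hdelta => //; rewrite ger0_norm.
Qed.

Lemma flow_mean_dyadic n x : D x ->
  N (alpha (dyadic R n) (phi x) - phi x) <= dyadic R n * (delta * N x).
Proof.
move=> Dx; apply: le_trans (flow_mean_lip halpha n x) _.
by rewrite ler_pM2l ?dyadic_gt0// hdelta// normr1.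
Qed.

Lemma flow_mean_lipnorm n x : D x ->
  lipnorm (dyadic R n) (phi x) <= (1 + delta) * N x.
Proof.
move=> Dx; rewrite mulrDl mul1r lerD//; first exact: flow_mean_le.
by rewrite ler_pdivrMl ?dyadic_gt0//; exact: flow_mean_dyadic.
Qed.

(** The norm and the difference quotient each split into three terms of size [delta * N x * N y],
    whence the 6. *)
Lemma flow_mean_defect n x y : D x -> D y ->
  lipnorm (dyadic R n) (defect phi x y) <= 6 * delta * N x * N y.
Proof.
move=> Dx Dy; have Dxy : D (x * y) by exact: subaM.
have d0 := dyadic_gt0 R n; have x0 := rnorm_ge0 x; have y0 := rnorm_ge0 y.
have le_xy := rnormM x y.
have dxy : delta * N (x * y) <= delta * (N x * N y) by rewrite ler_wpM2l.
have -> : 6 * delta * N x * N y =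
  3 * (delta * (N x * N y)) + 3 * (delta * (N x * N y)) by ring.
rewrite lerD//.
  have -> : defect phi x y = (phi (x * y) - x * y)
      - ((phi x - x) * y + phi x * (phi y - y)) by rewrite /defect; ncring.
  have h1 := rnormB (phi (x * y) - x * y) ((phi x - x) * y + phi x * (phi y - y)).
  have h2 := rnormD ((phi x - x) * y) (phi x * (phi y - y)).
  have h3 := rnormM_le (flow_mean_dist Dx) (lexx (N y)).
  have h4 := rnormM_le (flow_mean_le halpha x) (flow_mean_dist Dy).
  have h5 := flow_mean_dist Dxy.
  lra.
rewrite ler_pdivrMl//.
set a := alpha _.
have -> : a (defect phi x y) - defect phi x y = (a (phi (x * y)) - phi (x * y))
    - ((a (phi x) - phi x) * a (phi y) + phi x * (a (phi y) - phi y)).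
  by rewrite /defect /a flowB// flowM//; ncring.
have h1 := rnormB (a (phi (x * y)) - phi (x * y))
  ((a (phi x) - phi x) * a (phi y) + phi x * (a (phi y) - phi y)).
have h2 := rnormD ((a (phi x) - phi x) * a (phi y)) (phi x * (a (phi y) - phi y)).
have ay : N (a (phi y)) <= N y by rewrite /a flow_norm//; exact: flow_mean_le.
have h3 := rnormM_le (flow_mean_dyadic n Dx) ay.
have h4 := rnormM_le (flow_mean_le halpha x) (flow_mean_dyadic n Dy).
have h5 := flow_mean_dyadic n Dxy.
have h6 : dyadic R n * (delta * N (x * y)) <= dyadic R n * (delta * (N x * N y)).
  by rewrite ler_pM2l.
rewrite -/a in h3 h4 h5; lra.
Qed.

(** The iteration runs with [K = 1 + delta] and [tau = 6 * delta], so [12 * tau <= 1] is the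
    hypothesis on [72 * delta]. The constant 25 is [4 * 6] for the passage from the average to
    [rho], plus 1 for the average itself; the same [rho] serves all [n]. *)
Lemma exists_lipschitz_hom : exists rho, [/\ unital_star_hom_on D rho,
  forall x, D x -> N (rho x - x) <= 25 * delta * N x &
  forall n x, D x ->
    N (alpha (dyadic R n) (rho x) - rho x) <= 25 * delta * dyadic R n * N x].
Proof.
have d0 := delta0; have d72 := delta72.
have K0 : 0 <= 1 + delta by lra.
have tau0 : 0 <= 6 * delta by lra.
have Ktau : 1 + delta + 4 * (6 * delta) <= 2 by lra.
have tau12 : 12 * (6 * delta) <= 1 by lra.
have e0 n : 0 < dyadic R n by exact: dyadic_gt0.
have NK x : D x -> N (phi x) <= (1 + delta) * N x.
  by move=> Dx; apply: le_trans (rnorm_le_lipnorm _ (e0 0%N)) (flow_mean_lipnorm 0 Dx).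
have Ntau x y : D x -> D y -> N (defect phi x y) <= 6 * delta * N x * N y.
  by move=> Dx Dy; apply: le_trans (rnorm_le_lipnorm _ (e0 0%N)) (flow_mean_defect 0 Dx Dy).
have [rho [hrho near_phi]] := almost_hom_near_hom hD hM flow_mean_usl K0 tau0 Ktau tau12 NK Ntau.
exists rho; split => // [x Dx|n x Dx].
  have h1 := near_phi _ (algebra_norm_rnorm A) NK Ntau x Dx.
  have h2 := flow_mean_dist Dx.
  have := rnorm_dist3 (phi x) (rho x) x; lra.
have h1 := near_phi _ (lipnorm_algebra_norm (e0 n)) (@flow_mean_lipnorm n)
  (@flow_mean_defect n) x Dx.
have h2 := flow_mean_dyadic n Dx.
set a := alpha _ in h2 *.
have h3 : N (a (rho x - phi x) - (rho x - phi x)) <=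
    dyadic R n * (4 * (6 * delta) * N x).
  rewrite -ler_pdivrMl//; apply: le_trans h1; rewrite /lipnorm lerDr.
  exact: rnorm_ge0.
have -> : a (rho x) - rho x =
    (a (rho x - phi x) - (rho x - phi x)) + (a (phi x) - phi x).
  by rewrite /a flowB//; ncring.
have := rnormD (a (rho x - phi x) - (rho x - phi x)) (a (phi x) - phi x); lra.
Qed.

End Regularize.

(** * A unitary implementing a homomorphism close to the identity *)

Section Intertwiner.
Variables (R : realType) (A : unitalCStarType R) (D : set A).
Hypothesis hD : is_unital_cstar_subalgebra D.
Variables (M : (A -> A -> A) -> A).
Hypothesis hM : is_mean D M.
Variable rho : A -> A.
Hypothesis hrho : unital_star_hom_on D rho.
Implicit Types (x y z v w : A).
Local Notation N := (@rnorm R A).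
Local Open Scope complex_scope.

Lemma hom_unitary v : D v -> is_unitary v -> is_unitary (rho v).
Proof.
move=> Dv [h1 h2]; have Dsv := suba_star hD Dv.
by split; rewrite -(ush_star hrho)// -(ush_mul hrho)// (h1, h2) (ush_one hrho).
Qed.

Variable eta : R.
Hypothesis eta40 : 40 * eta <= 1.
Hypothesis heta : forall x, D x -> N (rho x - x) <= eta * N x.

(** [w] is the unitary part of the mean [W] of [rho v * star v]. As [star W * W] commutes with [D],
    so does its inverse square root [z], and [w = W * z] still intertwines. [W] contributes [eta] to
    the distance from 1, and [z] contributes [2 * eta]. *)
Lemma intertwining_unitary : exists w, [/\ is_unitary w, N (w - 1) <= 3 * eta &
  forall x, D x -> rho x * w = w * x].
Proof.
pose F v u := rho v * u.
have bF : rbilinear_on D F.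
  split=> z Dz a x y Dx Dy; rewrite /F; first by rewrite (ush_lin hrho)//; ncring.
  by ncring.
have b1 : rbilinear_on D (fun v u => v * u).
  by split=> z Dz a x y Dx Dy; ncring.
pose W := M F.
have W1 : N (W - 1) <= eta.
  have -> : W - 1 = M (fun v u => F v u - v * u).
    rewrite (meanB hM F) (mean_cst hM (F := fun v u => v * u) (c := 1))//.
    by move=> v _ [].
  apply: (mean_le hM (algebra_norm_rnorm A)); first exact: rbilinearB.
  move=> v Dv uv; rewrite /F -mulrBl.
  apply: rnormM1r; last by rewrite rnorm_star unitary_norm.
  by have := heta Dv; rewrite (unitary_norm uv) mulr1.
have NW : N W <= 1.
  apply: (mean_le hM (algebra_norm_rnorm A)) => // v Dv uv.
  apply: rnormM1r; last by rewrite rnorm_star unitary_norm.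
  by rewrite unitary_norm//; exact: hom_unitary.
have xW x : D x -> rho x * W = W * x.
  move=> Dx; rewrite -(mean_mull hM) -(mean_mulr hM).
  rewrite (mean_ext hM (G := fun v u => F (x * v) u)); last first.
    by move=> v u Dv _; rewrite /F (ush_mul hrho)// mulrA.
  rewrite (mean_invariant hM)//; apply: (mean_ext hM) => v u _ _.
  by rewrite /F mulrA.
have Wx x : D x -> x * star W = star W * rho x.
  move=> Dx; have := congr1 (@star R A) (xW _ (suba_star hD Dx)).
  by rewrite !star_mul (ush_star hrho)// !starK.
have e40 := eta40; have eta0 : 0 <= eta by apply: le_trans W1; exact: rnorm_ge0.
pose E := 1 - star W * W.
have sE : star E = E by rewrite starB star_mul starK star1.
have NE : N E <= 2 * eta.
  have -> : E = - ((star W - 1) + star W * (W - 1)) by rewrite /E; ncring.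
  rewrite rnormN; have h1 : N (star W - 1) <= eta.
    by rewrite -(star1 A) -starB rnorm_star.
  have h2 : N (star W * (W - 1)) <= eta by apply: rnormM1l => //; rewrite rnorm_star.
  have := rnormD (star W - 1) (star W * (W - 1)); lra.
have NE20 : N E <= 20^-1 by lra.
have [z [sz Ez z1 cz _]] := inv_sqrt sE NE20.
have zE := cz E erefl.
have WW : star W * W = 1 - E by rewrite /E opprB addrC subrK.
pose w := W * z.
have ww : star w * w = 1.
  by rewrite /w star_mul sz mulrA -(mulrA z) WW mulrBr mulr1 -zE -{1}(mul1r z) -mulrBl -mulrA.
have Nw : N w = 1.
  by apply/eqP; rewrite -(@eqrXn2 _ 2) ?rnorm_ge0// -rnorm_starM ww rnorm1 expr1n.
have w1 : N (w - 1) <= 3 * eta.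
  have -> : w - 1 = W * (z - 1) + (W - 1) by rewrite /w; ncring.
  have := rnormD (W * (z - 1)) (W - 1); have := rnormM1l NW (lexx (N (z - 1))).
  lra.
exists w; split => //.
  (* So far [w] is an isometry. The projection [p] has norm 0 or 1, and it is close to 0 because [w]
     is close to 1. *)
  split=> //; pose p := 1 - w * star w.
  have sp : star p = p by rewrite /p starB star_mul starK star1.
  have pp : p * p = p.
    have -> : p * p = 1 - 2 *: (w * star w) + w * (star w * w) * star w.
      by rewrite /p; ncring.
    by rewrite ww mulr1 /p; ncring.
  have Np : N p ^+ 2 = N p by rewrite -rnorm_starM sp pp.
  have p1 : N p <= 6 * eta.
    have -> : p = - ((w - 1) + w * star (w - 1)) by rewrite /p starB star1; ncring.
    rewrite rnormN; have := rnormD (w - 1) (w * star (w - 1)).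
    have := rnormM w (star (w - 1)); rewrite Nw mul1r rnorm_star; lra.
  have p0 : p = 0.
    apply/eqP; rewrite -rnorm_eq0; have := rnorm_ge0 p => p0.
    have : N p * (1 - N p) = 0 by rewrite mulrBr mulr1 -expr2 Np subrr.
    by move=> /eqP; rewrite mulf_eq0 => /orP[//|/eqP h]; exfalso; lra.
  by apply/eqP; rewrite eq_sym -subr_eq0; exact/eqP.
move=> x Dx; rewrite /w mulrA xW// -!mulrA; congr (_ * _); apply: cz.
rewrite /E mulrBr mulrBl mulr1 mul1r; congr (_ - _).
by rewrite mulrA Wx// -mulrA xW// mulrA.
Qed.

End Intertwiner.

(** * Construction of the cocycle *)

Section Sewing.
Variables (R : realType) (A : unitalCStarType R) (alpha : R -> A -> A).
Hypothesis halpha : is_flow alpha.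
Variable D : set A.
Hypothesis hD : is_unital_cstar_subalgebra D.
Variables (M : (A -> A -> A) -> A).
Hypothesis hM : is_mean D M.
Variable rho : A -> A.
Hypothesis hrho : unital_star_hom_on D rho.
Implicit Types (x y z v w : A).
Local Notation N := (@rnorm R A).
Local Notation d := (dyadic R).
Local Open Scope complex_scope.

Variable L : R.
Hypothesis L0 : 0 <= L.
Hypothesis hL : forall n x, D x -> N (alpha (d n) (rho x) - rho x) <= L * d n * N x.

Definition local_cocycle n : A := M (fun v u => rho v * alpha (d n) (rho u)).

Local Notation g := local_cocycle.

Let rho_norm v : D v -> is_unitary v -> N (rho v) = 1.
Proof. by move=> Dv uv; rewrite unitary_norm//; exact: (hom_unitary hD hrho). Qed.

Let bilin_g n : rbilinear_on D (fun v u => rho v * alpha (d n) (rho u)).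
Proof.
split=> z Dz a x y Dx Dy; rewrite (ush_lin hrho)//; first by ncring.
by rewrite flowD// flowZ//; ncring.
Qed.

Let bilin_rho : rbilinear_on D (fun v u => rho (v * u)).
Proof.
split=> z Dz a x y Dx Dy.
  by rewrite mulrDl cscalerl (ush_lin hrho)//; exact: subaM.
by rewrite mulrDr cscalerr (ush_lin hrho)//; exact: subaM.
Qed.

Let mean_rho : M (fun v u => rho (v * u)) = 1.
Proof. by apply: (mean_cst hM) => // v _ [_ ->]; exact: ush_one hrho. Qed.

Let gen_dist n v : D v -> is_unitary v ->
  N (rho v * alpha (d n) (rho (star v)) - 1) <= L * d n.
Proof.
move=> Dv uv; have Dsv := suba_star hD Dv.
have [_ h] := hom_unitary hD hrho Dv uv.
have -> : rho v * alpha (d n) (rho (star v)) - 1 =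
    rho v * (alpha (d n) (rho (star v)) - rho (star v)).
  by rewrite -h -(ush_star hrho)//; ncring.
apply: rnormM1l; first by rewrite rho_norm.
by have := hL n Dsv; rewrite rnorm_star (unitary_norm uv) mulr1.
Qed.

(** Contractivity makes errors in long products add up instead of being amplified. *)
Lemma local_cocycle_le1 n : N (g n) <= 1.
Proof.
apply: (mean_le hM (algebra_norm_rnorm A)) => // v Dv uv.
apply: rnormM1l; first by rewrite rho_norm.
by rewrite flow_norm// rho_norm//; [exact: suba_star|exact: unitary_star].
Qed.

Lemma local_cocycle_dist n : N (g n - 1) <= L * d n.
Proof.
rewrite -mean_rho -(meanB hM); apply: (mean_le hM (algebra_norm_rnorm A)).
  exact: rbilinearB.
by move=> v Dv uv; case: (uv) => _ ->; rewrite (ush_one hrho); exact: gen_dist.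
Qed.

Lemma local_cocycle_intertwine n x : D x ->
  g n * alpha (d n) (rho x) = rho x * g n.
Proof.
move=> Dx; rewrite -(mean_mull hM) -(mean_mulr hM).
rewrite [RHS](mean_ext hM (G := fun v u => rho (x * v) * alpha (d n) (rho u))); last first.
  by move=> v u Dv _; rewrite (ush_mul hrho)// mulrA.
rewrite (mean_invariant hM (bilin_g n) Dx); apply: (mean_ext hM) => v u _ Du.
by rewrite (ush_mul hrho)// flowM// mulrA.
Qed.

(* The defect is the mean of a product of two factors of order [d n.+1], as the
   mean of the first one alone vanishes. *)
Lemma local_cocycle_double n :
  N (g n.+1 * alpha (d n.+1) (g n.+1) - g n) <= 2 * (L * d n.+1) ^+ 2.
Proof.
set r := d n.+1; set h := g n.+1.
(* The last bracket has mean [h - h = 0]; subtracting it makes the integrand factor at the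
   unitaries. *)
pose F v u := h * (alpha r (rho v) * alpha r (alpha r (rho u)))
  - rho v * alpha (d n) (rho u) - (h * rho (v * u) - rho v * alpha r (rho u)).
have dE x : alpha (d n) x = alpha r (alpha r x) by rewrite -flow_add// -dyadicS.
have MF : M F = h * alpha r h - g n.
  rewrite /F (meanB hM (fun v u => h * (alpha r (rho v) * alpha r (alpha r (rho u)))
    - rho v * alpha (d n) (rho u))).
  rewrite (meanB hM (fun v u => h * (alpha r (rho v) * alpha r (alpha r (rho u))))).
  rewrite (meanB hM (fun v u => h * rho (v * u))) !(mean_mull hM) mean_rho mulr1.
  have -> : M (fun v u => rho v * alpha r (rho u)) = h by [].
  rewrite subrr subr0; congr (h * _ - _).
  rewrite /h -(mean_comp hM _ (g := alpha r)); last 2 first.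
  - exact: flowD.
  - by move=> s x; rewrite flowZ.
  by apply: (mean_ext hM) => v u _ _; rewrite flowM.
rewrite -MF; apply: (mean_le hM (algebra_norm_rnorm A)).
  apply: (rbilinearB (F := fun v u => h * (alpha r (rho v) * alpha r (alpha r (rho u)))
      - rho v * alpha (d n) (rho u)) (G := fun v u => h * rho (v * u) - rho v * alpha r (rho u))).
    apply: (rbilinearB (F := fun v u => h * (alpha r (rho v) * alpha r (alpha r (rho u))))) => //.
    split=> z Dz a x y Dx Dy; rewrite (ush_lin hrho)//.
      by rewrite flowD// flowZ//; ncring.
    by rewrite !(flowD halpha, flowZ halpha); ncring.
  apply: (rbilinearB (F := fun v u => h * rho (v * u))); last exact: bilin_g.
  have [b1 b2] := bilin_rho.
  split=> z Dz a x y Dx Dy; first by rewrite b1//; ncring.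
  by rewrite b2//; ncring.
move=> v Dv uv; have Dsv := suba_star hD Dv.
have [h1 h2] := hom_unitary hD hrho Dv uv.
have vv : rho (star v) * rho v = 1 by rewrite (ush_star hrho).
have -> : F v (star v) = (h - rho v * alpha r (rho (star v))) *
    (alpha r (rho v * alpha r (rho (star v)) - 1)).
  rewrite /F dE flowB// flow1// flowM//; case: (uv) => _ ->; rewrite (ush_one hrho).
  have e : alpha r (rho (star v)) * alpha r (rho v) = 1.
    by rewrite -flowM// vv flow1.
  set a := alpha r (rho (star v)) in e *; set b := alpha r (rho v) in e *.
  have -> : (h - rho v * a) * (b * alpha r a - 1) =
    h * (b * alpha r a) - rho v * (a * b) * alpha r a - (h - rho v * a) by ncring.
  by rewrite e; ncring.
have k1 := gen_dist n.+1 Dv uv; have k2 := local_cocycle_dist n.+1.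
have k3 : N (h - rho v * alpha r (rho (star v))) <= 2 * (L * r).
  have := rnorm_dist3 1 h (rho v * alpha r (rho (star v))).
  rewrite (rnorm_distC 1) -/r -/h in k1 k2 *; lra.
have k4 : N (alpha r (rho v * alpha r (rho (star v)) - 1)) <= L * r.
  by rewrite flow_norm.
by have := rnormM_le k3 k4; rewrite -mulrA -expr2.
Qed.

(** [g n] is a mean of unitaries [b] with [N (b - 1) <= L * d n]. For these, [b + star b - 2 = - (b
    - 1) * star (b - 1)] is of second order, and this bound is linear in [b], hence passes to the
    mean. *)
Lemma local_cocycle_unit n :
  N (1 - g n * star (g n)) <= 2 * (L * d n) ^+ 2 /\
  N (1 - star (g n) * g n) <= 2 * (L * d n) ^+ 2.
Proof.
have r1 := local_cocycle_dist n.
have r2 : N (star (g n) - 1) <= L * d n by rewrite -(star1 A) -starB rnorm_star.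
have q : N (g n + star (g n) - 2 *: 1) <= (L * d n) ^+ 2.
  pose G v u := alpha (d n) (rho v) * rho u.
  have bG : rbilinear_on D G.
    split=> z Dz a x y Dx Dy; rewrite /G (ush_lin hrho)//; last by ncring.
    by rewrite flowD// flowZ//; ncring.
  have sg : star (g n) = M G.
    rewrite -(mean_star hM).
    rewrite (mean_ext hM (G := fun v u => alpha (d n) (rho (star u)) * rho (star v))).
      apply: (mean_eq hM) => //.
        split=> z Dz a x y Dx Dy; rewrite starD starZr (ush_lin hrho).
        - by ncring.
        - exact: suba_star.
        - exact: suba_star.
        - by rewrite flowD// flowZ//; ncring.
        - exact: suba_star.
        - exact: suba_star.
      by move=> v Dv uv; rewrite starK.
    by move=> v u Dv Du; rewrite star_mul -flow_star// !(ush_star hrho).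
  have -> : g n + star (g n) - 2 *: 1 = M (fun v u => (rho v * alpha (d n) (rho u)
      - rho (v * u)) + (G v u - rho (v * u))).
    rewrite (meanD hM (fun v u => rho v * alpha (d n) (rho u) - rho (v * u))).
    rewrite (meanB hM (fun v u => rho v * alpha (d n) (rho u))) (meanB hM G).
    by rewrite mean_rho -sg /g; ncring.
  apply: (mean_le hM (algebra_norm_rnorm A)).
    have [b1 b2] := rbilinearB (bilin_g n) bilin_rho.
    have [b3 b4] := rbilinearB bG bilin_rho.
    split=> z Dz a x y Dx Dy; first by rewrite b1// b3//; ncring.
    by rewrite b2// b4//; ncring.
  move=> v Dv uv; have Dsv := suba_star hD Dv; case: (uv) => _ ->.
  rewrite (ush_one hrho).
  have k := gen_dist n Dv uv.
  set b := rho v * alpha (d n) (rho (star v)) in k *.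
  have sb : star b = G v (star v).
    by rewrite /b star_mul -flow_star// -!(ush_star hrho)// starK.
  have ub : is_unitary b.
    apply: unitaryM; first exact: (hom_unitary hD hrho).
    by apply: flow_unitary => //; apply: (hom_unitary hD hrho) => //; exact: unitary_star.
  rewrite -sb; have -> : b - 1 + (star b - 1) =
      - ((b - 1) * star (b - 1)) + (b * star b - 1) by rewrite starB star1; ncring.
  case: ub => _ ->; rewrite subrr addr0 rnormN expr2.
  by apply: rnormM_le => //; rewrite rnorm_star.
split.
  have -> : 1 - g n * star (g n) = - ((g n - 1) * (star (g n) - 1)
      + (g n + star (g n) - 2 *: 1)) by ncring.
  rewrite rnormN; have := rnormM_le r1 r2; rewrite -expr2 => h.
  have := rnormD ((g n - 1) * (star (g n) - 1)) (g n + star (g n) - 2 *: 1); lra.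
have -> : 1 - star (g n) * g n = - ((star (g n) - 1) * (g n - 1)
    + (g n + star (g n) - 2 *: 1)) by ncring.
rewrite rnormN; have := rnormM_le r2 r1; rewrite -expr2 => h.
have := rnormD ((star (g n) - 1) * (g n - 1)) (g n + star (g n) - 2 *: 1); lra.
Qed.

Fixpoint discrete_cocycle n m : A :=
  if m is m'.+1 then discrete_cocycle n m' * alpha (m'%:R * d n) (g n) else 1.

Local Notation W := discrete_cocycle.

Lemma discrete_cocycle_le1 n m : N (W n m) <= 1.
Proof.
elim: m => [|m IH] /=; first by rewrite rnorm1.
by apply: rnormM1l => //; rewrite flow_norm//; exact: local_cocycle_le1.
Qed.

Lemma discrete_cocycleD n m l :
  W n (m + l) = W n m * alpha (m%:R * d n) (W n l).
Proof.
elim: l => [|l IH]; first by rewrite addn0 flow1// mulr1.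
by rewrite addnS /= IH flowM// mulrA -flow_add// natrD mulrDl.
Qed.

Lemma discrete_cocycle_step n m : N (W n m.+1 - W n m) <= L * d n.
Proof.
rewrite /= -{2}(mulr1 (W n m)) -mulrBr.
apply: rnormM1l; first exact: discrete_cocycle_le1.
by rewrite -(flow1 halpha (m%:R * d n)) -flowB// flow_norm//; exact: local_cocycle_dist.
Qed.

Lemma discrete_cocycle_dist n m : N (W n m - 1) <= L * (m%:R * d n).
Proof.
elim: m => [|m IH]; first by rewrite /= subrr rnorm0 mul0r mulr0.
have := rnorm_dist3 (W n m) (W n m.+1) 1; have := discrete_cocycle_step n m.
rewrite -natr1; lra.
Qed.

Lemma discrete_cocycle_intertwine n m x : D x ->
  W n m * alpha (m%:R * d n) (rho x) = rho x * W n m.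
Proof.
move=> Dx; elim: m => [|m IH]; first by rewrite /= mul0r flow0// mul1r mulr1.
rewrite /= -natr1 mulrDl mul1r flow_add// -mulrA -flowM//.
by rewrite local_cocycle_intertwine// flowM// mulrA IH mulrA.
Qed.

Lemma discrete_cocycle_unit n m :
  N (1 - W n m * star (W n m)) <= m%:R * (2 * (L * d n) ^+ 2) /\
  N (1 - star (W n m) * W n m) <= m%:R * (2 * (L * d n) ^+ 2).
Proof.
have [g1 g2] := local_cocycle_unit n.
have gle := local_cocycle_le1 n.
elim: m => [|m [IH1 IH2]].
  by rewrite /= star1 mulr1 subrr rnorm0 mul0r.
have Wle := discrete_cocycle_le1 n m.
rewrite /= star_mul -flow_star//; set a := alpha _.
have aB x : 1 - a x = a (1 - x) by rewrite /a flowB// flow1.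
split.
  have -> : 1 - W n m * a (g n) * (a (star (g n)) * star (W n m)) =
    (1 - W n m * star (W n m)) + W n m * (1 - a (g n * star (g n))) * star (W n m).
    by rewrite /a flowM//; ncring.
  have h : N (W n m * (1 - a (g n * star (g n))) * star (W n m)) <= 2 * (L * d n) ^+ 2.
    apply: rnormM1r; last by rewrite rnorm_star.
    by apply: rnormM1l => //; rewrite aB flow_norm.
  apply: le_trans (rnormD _ _) _; rewrite -natr1; lra.
have -> : 1 - a (star (g n)) * star (W n m) * (W n m * a (g n)) =
  (1 - a (star (g n) * g n)) + a (star (g n)) * (1 - star (W n m) * W n m) * a (g n).
  by rewrite /a flowM//; ncring.
have h : N (a (star (g n)) * (1 - star (W n m) * W n m) * a (g n)) <=
    m%:R * (2 * (L * d n) ^+ 2).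
  apply: rnormM1r; last by rewrite flow_norm.
  by apply: rnormM1l => //; rewrite flow_norm// rnorm_star.
have h' : N (1 - a (star (g n) * g n)) <= 2 * (L * d n) ^+ 2 by rewrite aB flow_norm.
apply: le_trans (rnormD _ _) _; rewrite -natr1; lra.
Qed.

(** Each coarse step is exchanged for two fine ones at the cost of [local_cocycle_double], and the
    factors are contractions. For [m] about [t / d n] the total is of order [t * d n], summable in
    [n]. *)
Lemma discrete_cocycle_double n m :
  N (W n.+1 (m + m) - W n m) <= m%:R * (2 * (L * d n.+1) ^+ 2).
Proof.
elim: m => [|m IH]; first by rewrite /= subrr rnorm0 mul0r.
have -> : W n.+1 (m.+1 + m.+1) =
    W n.+1 (m + m) * alpha (m%:R * d n) (g n.+1 * alpha (d n.+1) (g n.+1)).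
  rewrite addSn addnS /= -mulrA flowM// -flow_add//.
  have -> : (m + m)%:R * d n.+1 = m%:R * d n by rewrite natrD (dyadicS R n); ring.
  have -> : (m + m).+1%:R * d n.+1 = m%:R * d n + d n.+1.
    by rewrite -natr1 natrD (dyadicS R n); ring.
  by [].
rewrite /=; set h := g n.+1 * _; set a := alpha _.
have -> : W n.+1 (m + m) * a h - W n m * a (g n) =
    (W n.+1 (m + m) - W n m) * a h + W n m * a (h - g n).
  by rewrite /a flowB//; ncring.
have h1 : N ((W n.+1 (m + m) - W n m) * a h) <= m%:R * (2 * (L * d n.+1) ^+ 2).
  apply: rnormM1r => //; rewrite flow_norm//.
  apply: rnormM1l; first exact: local_cocycle_le1.
  by rewrite flow_norm//; exact: local_cocycle_le1.
have h2 : N (W n m * a (h - g n)) <= 2 * (L * d n.+1) ^+ 2.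
  apply: rnormM1l; first exact: discrete_cocycle_le1.
  by rewrite flow_norm//; exact: local_cocycle_double.
apply: le_trans (rnormD _ _) _; rewrite -natr1; lra.
Qed.

End Sewing.

(** * The limit cocycle, for positive and then for all times *)

Section SewingLimit.
Variables (R : realType) (A : unitalCStarType R) (alpha : R -> A -> A).
Hypothesis halpha : is_flow alpha.
Variable D : set A.
Hypothesis hD : is_unital_cstar_subalgebra D.
Variables (M : (A -> A -> A) -> A).
Hypothesis hM : is_mean D M.
Variable rho : A -> A.
Hypothesis hrho : unital_star_hom_on D rho.
Implicit Types (x y z v w : A).
Local Notation N := (@rnorm R A).
Local Notation d := (dyadic R).
Local Open Scope complex_scope.

Variable L : R.
Hypothesis L0 : 0 <= L.
Hypothesis hL : forall n x, D x -> N (alpha (d n) (rho x) - rho x) <= L * d n * N x.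

Local Notation g := (local_cocycle alpha M rho).
Local Notation W := (discrete_cocycle alpha M rho).

Definition dyadic_index n (t : R) : nat := Num.truncn (t / d n).

Local Notation k := dyadic_index.

Lemma dyadic_index_itv n t : 0 <= t ->
  (k n t)%:R * d n <= t /\ t < (k n t)%:R * d n + d n.
Proof.
move=> t0; have d0 := dyadic_gt0 R n.
have := truncn_itv (divr_ge0 t0 (ltW d0)); rewrite -/(k n t) => /andP[h1 h2].
split; first by rewrite -ler_pdivlMr.
by rewrite -[X in _ + X]mul1r -mulrDl natr1 -ltr_pdivrMr.
Qed.

(** Rounding is off by at most one step, both on refining the grid and on adding two times. *)
Lemma dyadic_index_step (a n : nat) (t : R) : 0 <= t ->
  a%:R * d n <= t < a%:R * d n + (d n + d n) -> k n t = a \/ k n t = a.+1.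
Proof.
move=> t0 /andP[h1 h2]; have d0 := dyadic_gt0 R n.
have [l1 l2] := dyadic_index_itv n t0.
have ak : (a <= k n t)%N.
  by rewrite /k truncn_ge_nat ?divr_ge0 ?(ltW d0)// ler_pdivlMr.
have ka : (k n t < a.+2)%N.
  rewrite /k truncn_lt_nat ?divr_ge0 ?(ltW d0)// ltr_pdivrMr//.
  by rewrite -natr1 -natr1; lra.
move: ka; rewrite ltnS leq_eqVlt => /orP[/eqP ->|]; first by right.
by rewrite ltnS => ka; left; apply/eqP; rewrite eqn_leq ka.
Qed.

Definition approx_cocycle n t : A := W n (k n t).

Local Notation U := approx_cocycle.

Lemma approx_cocycle_cauchy n t : 0 <= t ->
  N (U n.+1 t - U n t) <= (L + L ^+ 2 * t) * 2^-1 ^+ n.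
Proof.
move=> t0; have d0 := dyadic_gt0 R n.+1; have l0 := L0.
have [h1 h2] := dyadic_index_itv n t0.
set a := k n t in h1 h2.
have dE := dyadicS R n.
have e : (a + a)%:R * d n.+1 = a%:R * d n by rewrite natrD dE; ring.
have c1 : N (W n.+1 (a + a) - W n a) <= L ^+ 2 * t * d n.+1.
  apply: le_trans (discrete_cocycle_double halpha hD hM hrho hL n a) _.
  have -> : a%:R * (2 * (L * d n.+1) ^+ 2) =
    (L ^+ 2 * d n.+1) * ((a + a)%:R * d n.+1) by rewrite natrD; ring.
  rewrite e [leLHS]mulrAC; apply: ler_wpM2r; first exact: ltW.
  by apply: ler_wpM2l => //; exact: sqr_ge0.
have step := discrete_cocycle_step halpha hD hM hrho hL n.+1 (a + a).
have -> : 2^-1 ^+ n = d n.+1 + d n.+1 by rewrite -dE.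
have p0 : 0 <= L * d n.+1 by rewrite mulr_ge0// ltW.
have q0 : 0 <= L ^+ 2 * t * d n.+1 by rewrite !mulr_ge0 ?sqr_ge0// ltW.
rewrite /approx_cocycle -/a.
have [|->|->] := @dyadic_index_step (a + a) n.+1 t t0.
- by rewrite e h1 /=; lra.
- lra.
have := rnorm_dist3 (W n.+1 (a + a)) (W n.+1 (a + a).+1) (W n a); lra.
Qed.

Definition half_cocycle t : A := lim ((fun n => U n t) @ \oo).

Lemma half_cocycle_cvg t : 0 <= t -> (fun n => U n t) @ \oo --> half_cocycle t.
Proof.
move=> t0; have [l [hl _]] := geometric_cvg (fun n => approx_cocycle_cauchy n t0).
by apply/cvg_ex; exists l.
Qed.

(** Time and argument vary together; as the flow is isometric, continuity along the orbit of the
    limit [l] suffices. *)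
Lemma flow_index_cvg (a : nat -> A) l t : 0 <= t -> a @ \oo --> l ->
  (fun n => alpha ((k n t)%:R * d n) (a n)) @ \oo --> alpha t l.
Proof.
move=> t0 al.
have c0 : (fun n => alpha ((k n t)%:R * d n) l) @ \oo --> alpha t l.
  apply/cvg_rnormP/cvgrPdist_lt => e e0.
  have [r r0 hr] := flow_near halpha l e0.
  have /cvgrPdist_lt/(_ _ r0)[m _ hm] := cvg_half_pow (1 : R).
  exists m => // n /= mn; rewrite sub0r normrN ger0_norm ?rnorm_ge0//.
  have [h1 h2] := dyadic_index_itv n t0.
  have -> : t = (k n t)%:R * d n + (t - (k n t)%:R * d n) by rewrite addrC subrK.
  rewrite (_ : k n (_ + _) = k n t); last by rewrite addrC subrK.
  rewrite flow_add// -flowB// flow_norm// rnorm_distC; apply: hr.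
  have := hm n mn; rewrite /= sub0r normrN mul1r ger0_norm; last by rewrite exprn_ge0// invr_ge0.
  rewrite ger0_norm -/(dyadic R n); lra.
apply: (@cvg_rnorm_le _ _ _ _ _ _ _ (fun n =>
    N (a n - l) + N (alpha ((k n t)%:R * d n) l - alpha t l))).
  near=> n; apply: le_trans (rnorm_dist3 (alpha ((k n t)%:R * d n) l) _ _) _.
  by rewrite -flowB// flow_norm.
rewrite -(addr0 0); apply: cvgD; exact/cvg_rnormP.
Unshelve. all: by end_near. Qed.

Lemma half_cocycle_dist t : 0 <= t -> N (half_cocycle t - 1) <= L * t.
Proof.
move=> t0; apply: (@cvg_rnorm_bound _ _ _ \oo _ (fun n => U n t - 1)).
  by apply: cvgB; [exact: half_cocycle_cvg|exact: cvg_cst].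
near=> n; apply: le_trans (discrete_cocycle_dist halpha hD hM hrho hL n _) _.
by rewrite ler_wpM2l//; have [] := dyadic_index_itv n t0.
Unshelve. all: by end_near. Qed.

Lemma half_cocycle_intertwine t x : 0 <= t -> D x ->
  half_cocycle t * alpha t (rho x) = rho x * half_cocycle t.
Proof.
move=> t0 Dx.
have h1 : (fun n => U n t * alpha ((k n t)%:R * d n) (rho x)) @ \oo -->
    half_cocycle t * alpha t (rho x).
  apply: cvg_cstarM; first exact: half_cocycle_cvg.
  by apply: flow_index_cvg => //; exact: cvg_cst.
apply: (cvg_eq h1 (cvg_mull (half_cocycle_cvg t0))) => n.
exact: (discrete_cocycle_intertwine halpha hM hrho n (k n t) Dx).
Qed.

Lemma half_cocycle_unitary t : 0 <= t -> is_unitary (half_cocycle t).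
Proof.
move=> t0; have hc := half_cocycle_cvg t0.
have b0 := cvg_half_pow (2 * L ^+ 2 * t).
have le n : (k n t)%:R * (2 * (L * d n) ^+ 2) <= (2 * L ^+ 2 * t) * 2^-1 ^+ n.
  have [h1 _] := dyadic_index_itv n t0; rewrite -/(dyadic R n).
  have -> : (k n t)%:R * (2 * (L * d n) ^+ 2) =
    (2 * L ^+ 2 * d n) * ((k n t)%:R * d n) by ring.
  rewrite [leRHS]mulrAC ler_wpM2l// !mulr_ge0 ?sqr_ge0// ltW// dyadic_gt0//.
split.
  apply: (cvg_eq (cvg_cstarM (cvg_star hc) hc) (g := fun n => star (U n t) * U n t)) => //.
  apply: (cvg_rnorm_le _ b0); near=> n; rewrite rnorm_distC; apply: le_trans (le n).
  by have [] := discrete_cocycle_unit halpha hD hM hrho hL n (k n t).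
apply: (cvg_eq (cvg_cstarM hc (cvg_star hc)) (g := fun n => U n t * star (U n t))) => //.
apply: (cvg_rnorm_le _ b0); near=> n; rewrite rnorm_distC; apply: le_trans (le n).
by have [] := discrete_cocycle_unit halpha hD hM hrho hL n (k n t).
Unshelve. all: by end_near. Qed.

(** The identity is exact on the grid; the indices of [s] and [t] add up to that of [s + t] except
    for at most one step, which costs [L * d n]. *)
Lemma half_cocycleD s t : 0 <= s -> 0 <= t ->
  half_cocycle s * alpha s (half_cocycle t) = half_cocycle (s + t).
Proof.
move=> s0 t0; have st0 : 0 <= s + t by rewrite addr_ge0.
have h1 : (fun n => U n s * alpha ((k n s)%:R * d n) (U n t)) @ \oo -->
    half_cocycle s * alpha s (half_cocycle t).
  by apply: cvg_cstarM; [|apply: flow_index_cvg => //]; exact: half_cocycle_cvg.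
apply/esym.
apply: (cvg_eq (g := fun n => U n (s + t)) (half_cocycle_cvg st0)) => //.
apply: (@cvg_rnorm_le _ _ _ _ _ _ _ (fun n => L * 2^-1 ^+ n +
   N (U n s * alpha ((k n s)%:R * d n) (U n t) - half_cocycle s * alpha s (half_cocycle t)))).
  near=> n.
  apply: le_trans (rnorm_dist3 (U n s * alpha ((k n s)%:R * d n) (U n t)) _ _) _.
  rewrite lerD2r -/(dyadic R n) /approx_cocycle -discrete_cocycleD//.
  have [s1 s2] := dyadic_index_itv n s0; have [t1 t2] := dyadic_index_itv n t0.
  have d0 := dyadic_gt0 R n.
  have [|->|->] := @dyadic_index_step (k n s + k n t) n (s + t) st0.
  - by rewrite natrD; lra.
  - by rewrite subrr rnorm0 mulr_ge0// ltW.
  - exact: (discrete_cocycle_step halpha hD hM hrho hL n).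
rewrite -(addr0 0); apply: cvgD; first exact: cvg_half_pow.
exact/cvg_rnormP.
Unshelve. all: by end_near. Qed.

(* Solves [half_cocycle (t + a) = u t * alpha t (half_cocycle a)] for [u t]. *)
Definition full_cocycle t : A :=
  half_cocycle (t + `|t|) * alpha t (star (half_cocycle `|t|)).

Lemma full_cocycleE a t : 0 <= a -> 0 <= t + a ->
  full_cocycle t = half_cocycle (t + a) * alpha t (star (half_cocycle a)).
Proof.
(* Enlarging [b] by [c] inserts [alpha (t + b) (half_cocycle c)] next to its adjoint. Any two
   admissible shifts thus agree with their sum. *)
have shift b c : 0 <= b -> 0 <= t + b -> 0 <= c ->
    half_cocycle (t + (b + c)) * alpha t (star (half_cocycle (b + c))) =
    half_cocycle (t + b) * alpha t (star (half_cocycle b)).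
  move=> b0 tb0 c0; rewrite addrA -(half_cocycleD tb0 c0) -(half_cocycleD b0 c0) star_mul flowM//.
  rewrite -flow_star// -flow_add//.
  have -> : half_cocycle (t + b) * alpha (t + b) (half_cocycle c) *
      (alpha (t + b) (star (half_cocycle c)) * alpha t (star (half_cocycle b))) =
    half_cocycle (t + b) * (alpha (t + b) (half_cocycle c) *
      alpha (t + b) (star (half_cocycle c))) * alpha t (star (half_cocycle b)) by ncring.
  rewrite -flowM//; have [_ ->] := half_cocycle_unitary c0.
  by rewrite flow1// mulr1.
move=> a0 ta0; have tt0 : 0 <= t + `|t|.
  by have := ler_norm (- t); rewrite normrN; lra.
rewrite -(shift a `|t|)// /full_cocycle -(shift `|t| a)//.
by rewrite (addrC a).
Qed.

Lemma full_cocycle_pos t : 0 <= t -> full_cocycle t = half_cocycle t.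
Proof.
move=> t0; rewrite (full_cocycleE (a := 0))// addr0//.
have -> : half_cocycle 0 = 1.
  apply/eqP; rewrite -subr_eq0 -rnorm_eq0 eq_le rnorm_ge0 andbT.
  by have := half_cocycle_dist (lexx 0); rewrite mulr0.
by rewrite star1 flow1// mulr1.
Qed.

Lemma full_cocycle_unitary t : is_unitary (full_cocycle t).
Proof.
apply: unitaryM.
  by apply: half_cocycle_unitary; have := ler_norm (- t); rewrite normrN; lra.
by apply: flow_unitary => //; apply: unitary_star; exact: half_cocycle_unitary.
Qed.

Lemma full_cocycleD s t :
  full_cocycle s * alpha s (full_cocycle t) = full_cocycle (s + t).
Proof.
pose a := `|s| + `|t|.
have h1 := ler_norm (- t); have h2 := ler_norm (- s); rewrite !normrN in h1 h2.
have s0 := normr_ge0 s; have t0 := normr_ge0 t.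
have a0 : 0 <= a by rewrite /a; lra.
have ta : 0 <= t + a by rewrite /a; lra.
have sta : 0 <= s + (t + a) by rewrite /a; lra.
rewrite (full_cocycleE a0 ta) (full_cocycleE ta sta).
rewrite (full_cocycleE (a := a))//; last by rewrite -addrA.
rewrite flowM// -flow_add//.
have [e _] := half_cocycle_unitary ta.
set p := half_cocycle (t + a) in e *.
have -> : half_cocycle (s + (t + a)) * alpha s (star p) *
  (alpha s p * alpha (s + t) (star (half_cocycle a))) =
  half_cocycle (s + (t + a)) * (alpha s (star p) * alpha s p) *
    alpha (s + t) (star (half_cocycle a)) by ncring.
by rewrite -flowM// e flow1// mulr1 addrA.
Qed.

(** For negative [t], the cocycle identity between [t] and [- t] transfers the bound from [- t]. *)
Lemma full_cocycle_dist t : N (full_cocycle t - 1) <= L * `|t|.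
Proof.
have [t0|t0] := leP 0 t.
  by rewrite full_cocycle_pos// ger0_norm//; exact: half_cocycle_dist.
have nt0 : 0 <= - t by lra.
have e : full_cocycle t * alpha t (full_cocycle (- t)) = 1.
  rewrite full_cocycleD subrr full_cocycle_pos//.
  apply/eqP; rewrite -subr_eq0 -rnorm_eq0 eq_le rnorm_ge0 andbT.
  by have := half_cocycle_dist (lexx 0); rewrite mulr0.
have -> : full_cocycle t - 1 = - (full_cocycle t * alpha t (full_cocycle (- t) - 1)).
  by rewrite flowB// flow1// mulrBr e mulr1 opprB.
rewrite rnormN; apply: rnormM1l; first by rewrite (unitary_norm (full_cocycle_unitary t)).
rewrite flow_norm// full_cocycle_pos// ltr0_norm//; exact: half_cocycle_dist.
Qed.

Lemma full_cocycle_intertwine t x : D x ->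
  full_cocycle t * alpha t (rho x) = rho x * full_cocycle t.
Proof.
move=> Dx; have Dsx := suba_star hD Dx.
have t0 : 0 <= t + `|t| by have := ler_norm (- t); rewrite normrN; lra.
have := congr1 (@star R A) (half_cocycle_intertwine (normr_ge0 t) Dsx).
rewrite !star_mul -flow_star// -!(ush_star hrho)// starK => h.
rewrite /full_cocycle -mulrA -flowM// -h flowM// -flow_add// mulrA.
by rewrite half_cocycle_intertwine// mulrA.
Qed.

Lemma full_cocycle_continuous : continuous full_cocycle.
Proof.
move=> t; apply: (@cvg_rnorm_le _ _ _ (nbhs t) _ _ _ (fun s => L * `|s - t|)).
  near=> s.
  have -> : full_cocycle s = full_cocycle t * alpha t (full_cocycle (s - t)).
    by rewrite full_cocycleD addrC subrK.
  have -> : full_cocycle t * alpha t (full_cocycle (s - t)) - full_cocycle t =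
      full_cocycle t * alpha t (full_cocycle (s - t) - 1).
    by rewrite flowB// flow1// mulrBr mulr1.
  apply: rnormM1l; first by rewrite (unitary_norm (full_cocycle_unitary t)).
  by rewrite flow_norm//; exact: full_cocycle_dist.
rewrite -(mulr0 L); apply: cvgM; first exact: cvg_cst.
rewrite -(@normr0 _ R) -(subrr t); apply: cvg_norm.
by apply: cvgB; [exact: cvg_id|exact: cvg_cst].
Unshelve. all: by end_near. Qed.

End SewingLimit.

(** * Return to the original subalgebra *)

Section Assembly.
Variables (R : realType) (A : unitalCStarType R) (alpha : R -> A -> A).
Variable D : set A.
Implicit Types (x y z v w : A).
Local Notation N := (@rnorm R A).
Local Open Scope complex_scope.

Lemma opnorm_le delta :
  (ereal_sup [set opnorm_on D (fun x => (alpha t x - x)%R)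
             | t in [set t : R | (`|t| <= 1)%R]] < delta%:E)%E ->
  is_flow alpha -> is_unital_cstar_subalgebra D ->
  forall t x, `|t| <= 1 -> D x -> N (alpha t x - x) <= delta * N x.
Proof.
move=> hsup halpha hD t x t1 Dx.
have [->|x0] := eqVneq x 0.
  by rewrite (aut0 (flow_aut halpha t)) subrr rnorm0 mulr0.
have Nx : 0 < N x by rewrite lt_def rnorm_eq0 x0 rnorm_ge0.
pose y := ((N x)^-1)%:C *: x.
have Ny : N y = 1 by rewrite /y rnormZ gtr0_norm ?invr_gt0// mulVf// gt_eqF.
have Dy : D y by exact: subaZ.
have h : N (alpha t y - y) <= delta.
  rewrite -lee_fin; apply/ltW/(le_lt_trans _ hsup).
  apply: (@le_trans _ _ (opnorm_on D (fun x => alpha t x - x))).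
    by apply: ereal_sup_ubound; exists y => //=; rewrite Ny.
  by apply: ereal_sup_ubound; exists t.
move: h; rewrite /y (flowZ halpha) -scalerBr rnormZ gtr0_norm ?invr_gt0//.
by rewrite ler_pdivrMl// mulrC.
Qed.

(* [u] differs from [U] by the coboundary of [w], where [w D w^* = rho D]. *)
Lemma conjugate_cocycle rho U w (L eta : R) :
  is_flow alpha -> is_unital_cstar_subalgebra D ->
  is_unitary w -> N (w - 1) <= eta -> 0 <= L ->
  (forall x, D x -> rho x * w = w * x) ->
  is_cocycle alpha U -> (forall t x, D x -> U t * alpha t (rho x) = rho x * U t) ->
  (forall t, N (U t - 1) <= L * `|t|) ->
  let u t := star w * U t * alpha t w in
  [/\ is_cocycle alpha u, forall t x, D x -> Ad (u t) (alpha t x) = x &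
    forall t, `|t| <= 1 -> N (u t - 1) <= L + 2 * eta].
Proof.
move=> halpha hD uw weta L0 rhow [Uu Uc UD] Urho Udist u.
have [w1 w2] := uw.
have uu t : is_unitary (u t).
  by apply: unitaryM; [apply: unitaryM => //; exact: unitary_star|exact: flow_unitary].
split.
- split => // [t|s t].
    apply: (@cvg_cstarM _ _ _ (nbhs t)); last by case: halpha => _ _; apply.
    by apply: (@cvg_mull _ _ _ (nbhs t)); exact: Uc.
  rewrite /u !(flowM halpha) -(flow_add halpha).
  have -> : star w * U s * alpha s w * (alpha s (star w) * alpha s (U t) * alpha (s + t) w)
    = star w * U s * (alpha s w * alpha s (star w)) * alpha s (U t) * alpha (s + t) w.
    by ncring.
  by rewrite -(flowM halpha) w2 (flow1 halpha) mulr1 -(mulrA (star w)) UD.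
- move=> t x Dx; have wr : star w * rho x = x * star w.
    by rewrite -[LHS]mulr1 -w2 mulrA -(mulrA (star w)) rhow// mulrA w1 mul1r.
  have ux : u t * alpha t x = x * u t.
    rewrite /u -mulrA -(flowM halpha) -rhow// (flowM halpha) mulrA -(mulrA (star w)).
    by rewrite Urho// mulrA wr !mulrA.
  by rewrite /Ad ux -mulrA; case: (uu t) => _ ->; rewrite mulr1.
move=> t t1; have Nw := unitary_norm uw.
have Nsw : N (star w) = 1 by rewrite rnorm_star.
(* The first term carries the distance of [U t] from 1. In the second, [alpha t w - w] is written
   through [w - 1], which gives [2 * eta] independently of [t]. *)
have -> : u t - 1 = star w * (U t - 1) * alpha t w +
    star w * (alpha t (w - 1) - (w - 1)).
  by rewrite (flowB halpha) (flow1 halpha) -[X in _ - X = _]w1 /u; ncring.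
have h1 : N (star w * (U t - 1) * alpha t w) <= L.
  apply: rnormM1r; last by rewrite (flow_norm halpha) Nw.
  apply: rnormM1l; first by rewrite Nsw.
  by apply: le_trans (Udist t) _; rewrite ler_piMr.
have h2 : N (star w * (alpha t (w - 1) - (w - 1))) <= 2 * eta.
  apply: rnormM1l; first by rewrite Nsw.
  apply: le_trans (rnormB _ _) _; rewrite (flow_norm halpha); lra.
apply: le_trans (rnormD _ _) _; lra.
Qed.

Lemma cocycle_maximum (u : R -> A) (c : R) : continuous u ->
  (forall t, `|t| <= 1 -> N (u t - 1) <= c) ->
  exists2 m : R, is_maximum [set N (u t - 1) | t in [set t : R | `|t| <= 1]] m
    & m <= c.
Proof.
move=> uc hc.
have fc : continuous (fun t => N (u t - 1)).
  move=> t; apply: (@cvg_rnorm _ _ _ (nbhs t)); apply: cvgB; [exact: uc|exact: cvg_cst].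
have [|t ht tmax] := @EVT_max R (fun t => N (u t - 1)) (-1) 1 _ (continuous_subspaceT fc).
  by lra.
have t1 : `|t| <= 1 by move: ht; rewrite in_itv /= ler_norml.
exists (N (u t - 1)); last exact: hc.
split; first by exists t.
by move=> _ [s s1 <-]; apply: tmax; rewrite in_itv /= -ler_norml.
Qed.

End Assembly.

Unset Implicit Arguments.

Theorem proposition1p6 (R : realType) (eps : R) (heps : 0 < eps) :
  exists2 delta : R, 0 < delta &
    forall (A : unitalCStarType R) (alpha : R -> A -> A) (D : set A),
      is_flow alpha ->
      is_unital_cstar_subalgebra D ->
      finite_dimensional D ->
      (ereal_sup [set opnorm_on D (fun x => (alpha t x - x)%R)
                 | t in [set t : R | (`|t| <= 1)%R]] < delta%:E)%E ->
      exists u : R -> A,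
        [/\ is_cocycle alpha u,
            forall (t : R) (x : A), D x -> Ad (u t) (alpha t x) = x
          & exists2 m : R,
              is_maximum [set rnorm (u t - 1) | t in [set t : R | `|t| <= 1]] m
              & m < eps].
Proof.
(* The bound 1/1000 is what [40 * (25 * delta) <= 1] requires. The final distance is [L + 2 * eta]
   with [L = 25 * delta] and [eta = 3 * (25 * delta)], that is [175 * delta], strictly below
   [eps]. *)
pose delta := Num.min (1000^-1) (eps / 200).
have d1 : delta <= 1000^-1 by rewrite ge_min lexx.
have d2 : delta <= eps / 200 by rewrite ge_min lexx orbT.
have d0 : 0 < delta by rewrite lt_min invr_gt0 ltr0n divr_gt0.
exists delta => // A alpha D halpha hD fD hsup.
have hdelta := opnorm_le hsup halpha hD.
have [M hM] := exists_mean hD fD.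
have dle0 := ltW d0.
have d72 : 72 * delta <= 1 by lra.
have [rho [hrho rho1 rhoL]] := exists_lipschitz_hom halpha hD hM dle0 d72 hdelta.
have e40 : 40 * (25 * delta) <= 1 by lra.
have [w [uw w1 rhow]] := intertwining_unitary hD hM hrho e40 rho1.
have L0 : 0 <= 25 * delta by lra.
have Uco : is_cocycle alpha (full_cocycle alpha M rho).
  split; [exact: (full_cocycle_unitary halpha hD hM hrho L0 rhoL)
         |exact: (full_cocycle_continuous halpha hD hM hrho L0 rhoL)
         |exact: (full_cocycleD halpha hD hM hrho L0 rhoL)].
have [uco uAd udist] := conjugate_cocycle halpha hD uw w1 L0 rhow Uco
  (full_cocycle_intertwine halpha hD hM hrho L0 rhoL)
  (full_cocycle_dist halpha hD hM hrho L0 rhoL).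
set u := fun t : R => _ in uco uAd udist.
exists u; split => //.
have [_ uc _] := uco.
have [m hm mle] := cocycle_maximum uc udist.
by exists m => //; lra.
Qed.
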